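(* Let $k$ be an algebraically closed field of characteristic $0$ and let $p$ be an odd prime. There exists an infinite family of pairwise non-isomorphic pointed Hopf algebras over $k$ of dimension $p^4$.
   Context: A Hopf algebra is pointed if all its simple subcoalgebras are one-dimensional. Isomorphism means isomorphism of Hopf algebras over $k$. *)

(* Defs.v *)
From HB Require Import structures.
From mathcomp Require Import all_boot all_order all_algebra all_field.

Set Implicit Arguments.
Unset Strict Implicit.
Unset Printing Implicit Defensive.

Import GRing.Theory.
Local Open Scope ring_scope.

(* The tensor product of two finite-dimensional spaces V and W, presented in  *)
(* coordinates: the (i, j) entry is the coefficient of e_i *t f_j, where      *)
(* e = vbasis {:V} and f = vbasis {:W}. Only the Vector structure of matrices *)
(* is transferred, so that matrix multiplication is not available on tensors. *)
Definition tensor (k : fieldType) (V W : vectType k) : Type :=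
  'M[k]_(\dim {:V}, \dim {:W}).

HB.instance Definition _ (k : fieldType) (V W : vectType k) :=
  Vector.copy (tensor V W) 'M[k]_(\dim {:V}, \dim {:W}).

Definition tens (k : fieldType) (V W : vectType k) (v : V) (w : W) :
    tensor V W :=
  \matrix_(i, j) (coord (vbasis {:V}) i v * coord (vbasis {:W}) j w).

Notation "v '*t' w" := (tens v w) (at level 40, left associativity).

(* The linear map on V (x) W induced by a bilinear map B; see tliftE. *)
Definition tlift (k : fieldType) (V W : vectType k) (U : lmodType k)
    (B : V -> W -> U) (t : tensor V W) : U :=
  \sum_i \sum_j (t : 'M_(_, _)) i j *: B (vbasis {:V})`_i (vbasis {:W})`_j.

Section TensorTheory.

Variables (k : fieldType) (V W : vectType k).

Lemma tliftP (U : lmodType k) (B : V -> W -> U) : linear (tlift B).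
Proof.
move=> a s t; rewrite /tlift scaler_sumr -big_split; apply: eq_bigr => i _.
rewrite scaler_sumr -big_split; apply: eq_bigr => j _ /=.
by rewrite !mxE scalerDl scalerA.
Qed.

Lemma tliftE (U : lmodType k) (B : V -> W -> U) v w :
    (forall w', linear (B^~ w')) -> (forall v', linear (B v')) ->
  tlift B (v *t w) = B v w.
Proof.
move=> linl linr.
pose Bl w' : {linear V -> U} :=
  HB.pack (B^~ w') (GRing.isLinear.Build _ _ _ _ (B^~ w') (linl w')).
pose Br v' : {linear W -> U} :=
  HB.pack (B v') (GRing.isLinear.Build _ _ _ _ (B v') (linr v')).
have vE := coord_vbasis (memvf v); have wE := coord_vbasis (memvf w).
rewrite -[RHS]/(Bl w v) [in RHS]vE linear_sum; apply: eq_bigr => i _.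
rewrite linearZ /= -[B _ w]/(Br _ w) [in RHS]wE linear_sum scaler_sumr.
by apply: eq_bigr => j _; rewrite linearZ mxE scalerA.
Qed.

Lemma tensor_span (t : tensor V W) : t = tlift (@tens k V W) t.
Proof.
apply/matrixP=> i j; rewrite /tlift summxE (bigD1 i) //= summxE (bigD1 j) //=.
have freeV := basis_free (vbasisP {:V}); have freeW := basis_free (vbasisP {:W}).
rewrite !mxE !coord_free // !eqxx !mulr1 big1 => [|j' /negPf nej]; last first.
  by rewrite !mxE !coord_free // nej !mulr0.
rewrite addr0 big1 ?addr0 // => i' /negPf nei; rewrite summxE big1 // => j' _.
by rewrite !mxE !coord_free // nei mul0r mulr0.
Qed.

End TensorTheory.

Definition tens_map (k : fieldType) (V V' W W' : vectType k)
    (f : V -> V') (g : W -> W') : tensor V W -> tensor V' W' :=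
  tlift (fun v w => f v *t g w).

Definition tens_assoc (k : fieldType) (V W U : vectType k) :
    tensor (tensor V W) U -> tensor V (tensor W U) :=
  tlift (fun vw u => tlift (fun v w => v *t (w *t u)) vw).

(* The product of A (x) B, with (a *t b) (a' *t b') = (a * a') *t (b * b'). *)
Definition tens_mul (k : fieldType) (A B : falgType k) (s t : tensor A B) :
    tensor A B :=
  tlift (fun a b => tlift (fun a' b' => (a * a') *t (b * b')) t) s.

(* The subspace U (x) U' of V (x) W. *)
Definition tens_space (k : fieldType) (V W : vectType k)
    (U : {vspace V}) (U' : {vspace W}) : {vspace tensor V W} :=
  <<[seq u *t u' | u <- vbasis U, u' <- vbasis U']>>%VS.

Section HopfLaws.

Variable k : fieldType.

Definition coassociative (C : vectType k) (D : C -> tensor C C) : Prop :=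
  forall x, tens_assoc (tens_map D idfun (D x)) = tens_map idfun D (D x).

Definition counital (C : vectType k) (D : C -> tensor C C) (e : C -> k) :
    Prop :=
  forall x, tlift (fun a b => e a *: b) (D x) = x
         /\ tlift (fun a b => e b *: a) (D x) = x.

Definition comul_multiplicative (H : falgType k) (D : H -> tensor H H) : Prop :=
  D 1 = 1 *t 1 /\ forall x y, D (x * y) = tens_mul (D x) (D y).

Definition counit_multiplicative (H : falgType k) (e : H -> k) : Prop :=
  e 1 = 1 /\ forall x y, e (x * y) = e x * e y.

Definition antipodal (H : falgType k) (D : H -> tensor H H) (e : H -> k)
    (S : H -> H) : Prop :=
  forall x, tlift (fun a b => S a * b) (D x) = (e x)%:A
         /\ tlift (fun a b => a * S b) (D x) = (e x)%:A.

End HopfLaws.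

HB.mixin Record Vector_isCoalgebra (k : fieldType) C of Vector k C := {
  comul : {linear C -> tensor C C};
  counit : {linear C -> k^o};
  comulA : coassociative comul;
  counitP : counital comul counit
}.

#[short(type="coalgType")]
HB.structure Definition Coalgebra (k : fieldType) :=
  {C of Vector_isCoalgebra k C & Vector k C}.

HB.mixin Record Falgebra_isHopfAlgebra (k : fieldType) H
    of Falgebra k H & Coalgebra k H := {
  antipode : {linear H -> H};
  comulM : comul_multiplicative (comul : H -> tensor H H);
  counitM : counit_multiplicative (counit : H -> k);
  antipodeP : antipodal (comul : H -> tensor H H) (counit : H -> k) antipode
}.

#[short(type="hopfAlgType")]
HB.structure Definition HopfAlgebra (k : fieldType) :=
  {H of Falgebra_isHopfAlgebra k H & Falgebra k H & Coalgebra k H}.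

Section Subcoalgebras.

Variables (k : fieldType) (C : coalgType k).
Implicit Types D E : {vspace C}.

Definition subcoalgebra D : Prop :=
  forall x, x \in D -> comul x \in tens_space D D.

Definition simple_subcoalgebra D : Prop :=
  [/\ subcoalgebra D, D <> 0%VS
    & forall E, subcoalgebra E -> (E <= D)%VS -> E = 0%VS \/ E = D].

Definition pointed : Prop :=
  forall D, simple_subcoalgebra D -> \dim D = 1%N.

End Subcoalgebras.

Arguments pointed {k} C.

Definition hopf_isomorphic (k : fieldType) (H K : hopfAlgType k) : Prop :=
  exists f : {lrmorphism H -> K},
    [/\ bijective f,
        forall x, comul (f x) = tens_map f f (comul x),
        forall x, counit (f x) = counit x
      & forall x, antipode (f x) = f (antipode x)].

(* Main.v *)
Require Import Defs.
From mathcomp Require Import all_boot all_order all_algebra all_field.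
From HB Require Import structures.
From mathcomp Require Import ring.

Set Implicit Arguments.
Unset Strict Implicit.
Unset Printing Implicit Defensive.

Import GRing.Theory.
Local Open Scope ring_scope.

(** Let q be a primitive p-th root of unity.  For a scalar lam, let H(lam) be
the algebra generated by g, x, y subject to
<<
    g^(p^2) = 1,   g x = q x g,   g y = q^-1 y g,   x^p = y^p = g^p - 1,
    y x = q x y + q lam (1 - g^2),
>>
made into a Hopf algebra in which g is group-like and x, y are skew-primitive:
the coproduct of x is x *t 1 + g *t x, and similarly for y.  It is a lifting of
a quantum plane over the cyclic group of order p^2, and the scalar lam, which
links x to y, is the source of the infinite family.

Existence and dimension.  The space with basis the monomials x^b y^c g^a, where
b, c < p and a < p^2, carries three operators that satisfy the relations
([regular_action]), and it is the free module on one generator for such triples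
of operators ([act_on]).  This freeness produces every piece of structure: the
product from the regular action, the coproduct from an action on H *t H, the
counit from an action on k, the antipode from an action on H by right
multiplications.  Each Hopf axiom is an identity between linear maps, verified
on 1 and propagated by left multiplication by g, x and y ([gen_ind]).  The
one point that is not formal is that the coproduct respects x^p = g^p - 1: the
p-th power of x *t 1 + g *t x is x^p *t 1 + g^p *t x^p because the intermediate
q-binomial coefficients vanish ([qbinomial_prim]).

Pointedness.  Contracting the second factor of the coproduct of h <> 0 with the
functional that reads a coefficient of h of maximal degree in x and y leaves a
nonzero multiple of a power of g ([top_slice]).  So every nonzero subcoalgebra
contains a group-like element, and a simple one is the line that it spans.

Non-isomorphism.  The same contraction shows that the group-like elements are
the powers of g.  An isomorphism from H(lam) to H(mu) therefore sends g to some
g^s and sends x, y to skew-primitive elements that are eigenvectors for the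
conjugation by g^s, with eigenvalues q and q^-1; comparing coefficients forces
g^s = g, and x, y are sent to a x, b y ([skewprim_eigen]).  The relations
x^p = y^p = g^p - 1 give a^p = b^p = 1 and the linking relation gives
lam = a b mu, so that lam^p = mu^p ([hopf_isomorphic_link]).  In characteristic
0 the scalars 0, 1, 2, ... have pairwise distinct p-th powers. *)

(** * Quantum integers and the quantum binomial formula *)

Section QuantumNumbers.

Variables (k : fieldType) (z : k).

Definition qint n : k := \sum_(i < n) z ^+ i.

Lemma qint0 : qint 0 = 0.
Proof. by rewrite /qint big_ord0. Qed.

Lemma qintS n : qint n.+1 = qint n + z ^+ n.
Proof. by rewrite /qint big_ord_recr. Qed.

Lemma qint1 : qint 1 = 1.
Proof. by rewrite qintS qint0 add0r. Qed.

Lemma qintSl n : qint n.+1 = 1 + z * qint n.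
Proof.
rewrite /qint big_ord_recl expr0 mulr_sumr; congr (_ + _).
by apply: eq_bigr => i _; rewrite -exprS.
Qed.

(** Gaussian binomial coefficients, with the form of Pascal's rule that
    computes (A + B)^n when B A = z A B. *)
Fixpoint qbin n i : k :=
  match n, i with
  | _, 0 => 1
  | 0, _.+1 => 0
  | n'.+1, i'.+1 => qbin n' i + z ^+ (n' - i') * qbin n' i'
  end.

Lemma qbin0 n : qbin n 0 = 1.
Proof. by case: n. Qed.

Lemma qbinS n i : qbin n.+1 i.+1 = qbin n i.+1 + z ^+ (n - i) * qbin n i.
Proof. by []. Qed.

Lemma qbin_small n i : (n < i)%N -> qbin n i = 0.
Proof.
elim: n i => [|n IHn] [|i] //; rewrite ltnS => lt_n_i.
by rewrite qbinS !IHn ?mulr0 ?addr0 // ltnW.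
Qed.

Lemma qbinn n : qbin n n = 1.
Proof.
by elim: n => // n IHn; rewrite qbinS qbin_small // add0r subnn IHn mulr1.
Qed.

Lemma qbin1 n : qbin n 1 = qint n.
Proof.
by elim: n => [|n IHn]; rewrite ?qint0 // qbinS IHn qintS subn0 qbin0 mulr1.
Qed.

Lemma qintD m n : qint (m + n) = qint m + z ^+ m * qint n.
Proof.
elim: n => [|n IHn]; first by rewrite addn0 qint0 mulr0 addr0.
by rewrite addnS !qintS IHn mulrDr addrA exprD.
Qed.

(** Free of denominators, this identity survives at a root of unity, where the
    formula with quantum factorials does not make sense. *)
Lemma qbin_absorb n i : (i <= n)%N ->
  qint i.+1 * qbin n i.+1 = qint (n - i) * qbin n i.
Proof.
elim: n i => [|n IHn] i; first by rewrite leqn0 => /eqP->; rewrite qint0 mulr0 mul0r.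
move=> le_i_n1; have [le_i_n|lt_n_i] := leqP i n; last first.
  have -> : i = n.+1 by apply/eqP; rewrite eqn_leq le_i_n1.
  by rewrite subnn qint0 mul0r qbin_small ?mulr0.
have -> : qint i.+1 * qbin n.+1 i.+1 = qint n.+1 * qbin n i.
  rewrite qbinS mulrDr IHn // mulrA [_ * z ^+ _]mulrC -mulrDl -qintD.
  by rewrite addnS subnK.
case: i le_i_n {le_i_n1} => [|i] le_i_n; first by rewrite !qbin0 subn0.
rewrite subSS qbinS mulrDr mulrCA -IHn ?(ltnW le_i_n) // mulrA -mulrDl.
by rewrite -qintD addnS subnK // ltnW.
Qed.

End QuantumNumbers.

Section PrimitiveRoot.

Variables (k : fieldType) (z : k) (n : nat).
Hypotheses (z_prim : n.-primitive_root z) (n_gt1 : (1 < n)%N).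

Lemma qint_eq0 m : (qint z m == 0) = (n %| m)%N.
Proof.
rewrite (prim_order_dvd z_prim) -[RHS]subr_eq0 subrX1 mulf_eq0.
suff /negPf-> : z - 1 != 0 by [].
by rewrite subr_eq0 -[z]expr1 -(prim_order_dvd z_prim) gtnNdvd.
Qed.

(** Since [n]_z = 0, the absorption identity gives the value 0 at i = 1, and it
    carries this value from i to i + 1 because [i + 1]_z <> 0 for i + 1 < n. *)
Lemma qbin_prim i : (0 < i < n)%N -> qbin z n i = 0.
Proof.
case: i => // i /= lt_i_n; suff /eqP : qint z i.+1 * qbin z n i.+1 = 0.
  by rewrite mulf_eq0 qint_eq0 gtnNdvd //= => /eqP.
rewrite qbin_absorb; last by rewrite ltnW // ltnW.
elim: i lt_i_n => [|i IHi] lt_i_n.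
  by rewrite subn0 (eqP (_ : qint z n == 0)) ?mul0r // qint_eq0.
have lt_i_n' := ltnW lt_i_n.
have /eqP := IHi lt_i_n'; rewrite -qbin_absorb; last by rewrite ltnW // ltnW.
by rewrite mulf_eq0 qint_eq0 gtnNdvd //= => /eqP->; rewrite mulr0.
Qed.

End PrimitiveRoot.

Section IterLinear.

Variables (R : pzRingType) (M : lmodType R) (f : {linear M -> M}) (n : nat).

Fact iter_linear : linear (iter n f).
Proof. by elim: n => [|n' IHn] a u v //=; rewrite IHn linearP. Qed.

HB.instance Definition _ := GRing.isLinear.Build R M M _ (iter n f) iter_linear.

End IterLinear.

Section TwistedOperators.

Variables (k : fieldType) (M : lmodType k) (z : k) (A B : {linear M -> M}).
Hypothesis BA : forall m, B (A m) = z *: A (B m).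

Lemma twist_iter n m : B (iter n A m) = z ^+ n *: iter n A (B m).
Proof.
elim: n m => [|n IHn] m; first by rewrite scale1r.
by rewrite !iterS BA IHn linearZ scalerA -exprS.
Qed.

Lemma qbinomial n m :
  iter n (fun v => A v + B v) m =
  \sum_(i < n.+1) qbin z n i *: iter (n - i) A (iter i B m).
Proof.
elim: n => [|n IHn]; first by rewrite big_ord1 scale1r.
rewrite iterS {}IHn !linear_sum /=.
transitivity (iter n.+1 A m
  + \sum_(i < n.+1) qbin z n i.+1 *: iter (n - i) A (iter i.+1 B m)
  + \sum_(i < n.+1) (z ^+ (n - i) * qbin z n i) *: iter (n - i) A (iter i.+1 B m)).
  congr (_ + _); last first.
    by apply: eq_bigr => i _; rewrite linearZ /= twist_iter scalerA mulrC.
  rewrite big_ord_recl [in RHS]big_ord_recr /= linearZ /= qbin0 scale1r subn0.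
  rewrite qbin_small // scale0r addr0; congr (_ + _); apply: eq_bigr => i _.
  by rewrite linearZ /= -iterS -[RHS]/(_ *: _) subnSK.
rewrite [RHS]big_ord_recl qbin0 scale1r subn0 -addrA; congr (_ + _).
rewrite -big_split; apply: eq_bigr => i _ /=.
by rewrite subSS -scalerDl.
Qed.

(** The reason why the coproduct is compatible with the p-th power relations. *)
Lemma qbinomial_prim n m : n.-primitive_root z -> (1 < n)%N ->
  iter n (fun v => A v + B v) m = iter n A m + iter n B m.
Proof.
move=> z_prim n_gt1; rewrite qbinomial.
case: n z_prim n_gt1 => // n z_prim n_gt1.
rewrite big_ord_recl big_ord_recr qbin0 lift0 qbinn !scale1r subn0 subnn.
rewrite big1 => [|i _]; first by rewrite /= add0r.
by rewrite lift0 (qbin_prim z_prim) ?scale0r //= ltnS ltn_ord.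
Qed.

End TwistedOperators.

(** * Moving y past powers of x *)

Section Straightening.

Variables (k : fieldType) (M : lmodType k) (q r : k) (G X Y : {linear M -> M}).
Hypothesis q0 : q != 0.
Hypothesis GX : forall m, G (X m) = q *: X (G m).
Hypothesis GY : forall m, G (Y m) = q^-1 *: Y (G m).
Hypothesis YX : forall m, Y (X m) = q *: X (Y m) + r *: (m - G (G m)).

(** Each of the b commutations contributes a linking term; once the factors
    G^2 are moved to the right, these terms add up to one multiple of [b]_q.
    For b = 0 the factor [0]_q = 0 hides the meaningless exponent b - 1. *)
Lemma straighten_yxn b m :
  Y (iter b X m) = q ^+ b *: iter b X (Y m)
    + (r * qint q b) *: (iter b.-1 X m - q ^+ b.-1 *: iter b.-1 X (G (G m))).
Proof.
elim: b m => [|b IHb] m; first by rewrite qint0 mulr0 scale0r addr0 scale1r.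
have GGX : G (G (iter b X m)) = q ^+ (b + b) *: iter b X (G (G m)).
  by rewrite (twist_iter GX) linearZ /= (twist_iter GX) scalerA exprD.
have XK u v : (r * qint q b) *: (X (iter b.-1 X u) - q ^+ b.-1 *: X (iter b.-1 X v))
    = (r * qint q b) *: (iter b X u - q ^+ b.-1 *: iter b X v).
  by case: (b) => [|b'] //; rewrite qint0 mulr0 !scale0r.
rewrite iterS YX IHb (linearD X) !(linearZ_LR X) (linearB X) (linearZ_LR X) XK GGX.
rewrite !scalerDr !scalerN !scalerA -!addrA -exprS; congr (_ + _).
rewrite addrA addrACA -opprD -!scalerDl; congr (_ *: _ - _ *: _).
  by rewrite qintSl; ring.
case: (b) => [|b'] /=; first by rewrite qint0 qint1 !expr0; ring.
by rewrite [qint q b'.+2]qintS exprD exprS; ring.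
Qed.

(** The linking term produced after i commutations carries a factor q^i, and
    moving its G^2 to the right adds q^(-2i): hence one quantum integer for q and
    one for q^-1.  Both vanish when n is the order of q. *)
Lemma straighten_ynx n m :
  iter n Y (X m) = q ^+ n *: X (iter n Y m)
    + r *: (qint q n *: iter n.-1 Y m - qint q^-1 n *: iter n.-1 Y (G (G m))).
Proof.
elim: n m => [|n IHn] m; first by rewrite !qint0 !scale0r subr0 scaler0 addr0 scale1r.
have GGY : G (G (iter n Y m)) = (q^-1 ^+ (n + n)) *: iter n Y (G (G m)).
  by rewrite (twist_iter GY) linearZ /= (twist_iter GY) scalerA exprD.
have YK z u : qint z n *: Y (iter n.-1 Y u) = qint z n *: iter n Y u.
  by case: (n) => [|n'] //; rewrite qint0 !scale0r.
rewrite iterS IHn (linearD Y) !(linearZ_LR Y) (linearB Y) !(linearZ_LR Y) YX !YK GGY.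
rewrite !scalerDr !scalerN !scalerA -!addrA -exprSr; congr (_ + _).
rewrite addrA addrACA -opprD -!scalerDl !qintS; congr (_ *: _ - _ *: _); first by ring.
by rewrite exprD !exprVn; field; rewrite expf_neq0.
Qed.

End Straightening.

(** * The free action on the span of the monomials *)

Record qdatum (k : fieldType) := QDatum {
  qord : nat;
  qroot : k;
  qord_prime : prime qord;
  qord_odd : odd qord;
  qroot_prim : qord.-primitive_root qroot
}.

(** The space of coefficient functions on the monomials x^b y^c g^a.  The scalar
    lam is a parameter of the type so that each value has its own product. *)
Definition linked (k : fieldType) (d : qdatum k) (lam : k) : Type :=
  {ffun 'I_(qord d) * 'I_(qord d) * 'I_(qord d ^ 2) -> k^o}.

HB.instance Definition _ (k : fieldType) (d : qdatum k) (lam : k) :=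
  Vector.copy (linked d lam) {ffun 'I_(qord d) * 'I_(qord d) * 'I_(qord d ^ 2) -> k^o}.

(** A module over the algebra H(lam), described by the operators of the
    generators so that it makes sense before H(lam) is constructed. *)
Record linked_action (k : fieldType) (d : qdatum k) (lam : k) (M : lmodType k) :=
  LinkedAction {
    opg : {linear M -> M};
    opx : {linear M -> M};
    opy : {linear M -> M};
    opg_order m : iter (qord d ^ 2) opg m = m;
    opgx m : opg (opx m) = qroot d *: opx (opg m);
    opgy m : opg (opy m) = (qroot d)^-1 *: opy (opg m);
    opyx m : opy (opx m) =
      qroot d *: opx (opy m) + (qroot d * lam) *: (m - opg (opg m));
    opx_pow m : iter (qord d) opx m = iter (qord d) opg m - m;
    opy_pow m : iter (qord d) opy m = iter (qord d) opg m - m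
  }.

Section Basis.

Variables (k : fieldType) (d : qdatum k) (lam : k).
Local Notation p := (qord d).
Local Notation V := (linked d lam).

(** Exponents of g count modulo p^2; the value is 0 if b or c is at least p. *)
Definition lmono b c a : V :=
  [ffun i : 'I_p * 'I_p * 'I_(p ^ 2) =>
    ((i.1.1 == b :> nat) && (i.1.2 == c :> nat)
      && (i.2 == (a %% p ^ 2)%N :> nat))%:R].

Lemma qord_gt1 : (1 < p)%N. Proof. exact: prime_gt1 (qord_prime d). Qed.
Lemma qord_gt0 : (0 < p)%N. Proof. exact: prime_gt0 (qord_prime d). Qed.
Lemma sqr_qord_gt0 : (0 < p ^ 2)%N. Proof. by rewrite expn_gt0 qord_gt0. Qed.

Lemma lmono_mod b c a : lmono b c (a %% p ^ 2) = lmono b c a.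
Proof. by apply/ffunP=> i; rewrite !ffunE modn_mod. Qed.

Lemma lmonoD_mod b c a n : lmono b c (a %% p ^ 2 + n) = lmono b c (a + n).
Proof. by rewrite -lmono_mod modnDml lmono_mod. Qed.

Lemma lmono_sum (v : V) :
  v = \sum_(i : 'I_p * 'I_p * 'I_(p ^ 2)) (v i : k) *: lmono i.1.1 i.1.2 i.2.
Proof.
apply/ffunP=> -[[b c] a]; rewrite sum_ffunE (bigD1 (b, c, a)) //= big1.
  by rewrite addr0 !ffunE /= modn_small // !eqxx /GRing.scale /= mulr1.
case=> [[b' c'] a'] /=; rewrite -!pair_eqE /= => ne; rewrite !ffunE /=.
rewrite modn_small // [b == b' :> nat]eq_sym [c == c' :> nat]eq_sym.
by rewrite [a == a' :> nat]eq_sym !val_eqE (negPf ne) scaler0.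
Qed.

Section Extension.

Variables (M : lmodType k) (F : nat -> nat -> nat -> M).

Definition lmono_ext (v : V) : M :=
  \sum_(i : 'I_p * 'I_p * 'I_(p ^ 2)) (v i : k) *: F i.1.1 i.1.2 i.2.

Fact lmono_ext_linear : linear lmono_ext.
Proof.
move=> a u v; rewrite /lmono_ext scaler_sumr -big_split; apply: eq_bigr => i _.
by rewrite !ffunE scalerDl scalerA.
Qed.

HB.instance Definition _ := GRing.isLinear.Build k V M _ lmono_ext lmono_ext_linear.

Lemma lmono_extE b c a : (b < p)%N -> (c < p)%N ->
  (forall b' c' a', F b' c' (a' %% p ^ 2) = F b' c' a') ->
  lmono_ext (lmono b c a) = F b c a.
Proof.
move=> lt_b lt_c Fmod; have lt_a : (a %% p ^ 2 < p ^ 2)%N by rewrite ltn_mod sqr_qord_gt0.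
rewrite /lmono_ext (bigD1 (Ordinal lt_b, Ordinal lt_c, Ordinal lt_a)) //= big1.
  by rewrite ffunE /= !eqxx scale1r addr0 Fmod.
case=> [[b' c'] a'] /=; rewrite -!pair_eqE /= -!val_eqE /= => ne.
by rewrite ffunE /= (negPf ne) scale0r.
Qed.

End Extension.

Lemma linked_ext (M : lmodType k) (f h : {linear V -> M}) :
  (forall b c a, (b < p)%N -> (c < p)%N -> f (lmono b c a) = h (lmono b c a)) ->
  f =1 h.
Proof.
move=> eq_fh v; rewrite [v]lmono_sum !linear_sum; apply: eq_bigr => i _.
by rewrite !linearZ /= eq_fh.
Qed.

End Basis.

Arguments lmono {k d lam}.

Section RegularAction.

Variables (k : fieldType) (d : qdatum k) (lam : k).
Local Notation p := (qord d).
Local Notation q := (qroot d).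
Local Notation V := (linked d lam).

Lemma qroot_neq0 : q != 0.
Proof. by rewrite (prim_root_eq0 (qroot_prim d)) -lt0n qord_gt0. Qed.

Lemma qrootV_prim : p.-primitive_root q^-1.
Proof.
have -> : q^-1 = q ^+ p.-1.
  apply: (mulfI qroot_neq0); rewrite mulfV ?qroot_neq0 // -exprS.
  by rewrite prednK ?qord_gt0 // prim_expr_order // qroot_prim.
rewrite prim_root_exp_coprime ?qroot_prim //.
by rewrite coprime_sym -[X in coprime X]prednK ?qord_gt0 // coprimeSn.
Qed.

Lemma qexp_ord : q ^+ p = 1. Proof. exact: prim_expr_order (qroot_prim d). Qed.

Lemma qint_ord : qint q p = 0.
Proof. by apply/eqP; rewrite (qint_eq0 (qroot_prim d)) // qord_gt1. Qed.

Lemma qintV_ord : qint q^-1 p = 0.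
Proof. by apply/eqP; rewrite (qint_eq0 qrootV_prim) // qord_gt1. Qed.

Definition reg_g : V -> V :=
  lmono_ext (fun b c a => (q ^+ b * q^-1 ^+ c) *: lmono b c a.+1).

(** Normal form of x^b y^c g^a for b <= p, in which x^p is replaced by the
    central element g^p - 1; [wrapy] does the same for the exponent of y. *)
Definition wrapx b c a : V :=
  if (b < p)%N then lmono b c a else lmono 0 c (a + p) - lmono 0 c a.

Definition wrapy b c a : V :=
  if (c < p)%N then lmono b c a else lmono b 0 (a + p) - lmono b 0 a.

Definition reg_x : V -> V := lmono_ext (fun b c a => wrapx b.+1 c a).

(** The formula is [straighten_yxn], where G^2 has moreover been moved past y^c. *)
Definition reg_y : V -> V :=
  lmono_ext (fun b c a => q ^+ b *: wrapy b c.+1 a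
    + (q * lam * qint q b)
      *: (lmono b.-1 c a - (q ^+ b.-1 * q^-1 ^+ (c + c)) *: lmono b.-1 c (a + 2))).

HB.instance Definition _ := GRing.Linear.on reg_g.
HB.instance Definition _ := GRing.Linear.on reg_x.
HB.instance Definition _ := GRing.Linear.on reg_y.

Lemma reg_gE b c a : (b < p)%N -> (c < p)%N ->
  reg_g (lmono b c a) = (q ^+ b * q^-1 ^+ c) *: lmono b c a.+1.
Proof. by move=> ? ?; apply: lmono_extE => // *; rewrite -addn1 lmonoD_mod addn1. Qed.

Lemma wrapx_mod b c a : wrapx b c (a %% p ^ 2) = wrapx b c a.
Proof. by rewrite /wrapx lmonoD_mod !lmono_mod. Qed.

Lemma wrapy_mod b c a : wrapy b c (a %% p ^ 2) = wrapy b c a.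
Proof. by rewrite /wrapy lmonoD_mod !lmono_mod. Qed.

Lemma reg_xE b c a : (b < p)%N -> (c < p)%N ->
  reg_x (lmono b c a) = wrapx b.+1 c a.
Proof. by move=> ? ?; apply: lmono_extE => // *; apply: wrapx_mod. Qed.

Lemma reg_yE b c a : (b < p)%N -> (c < p)%N ->
  reg_y (lmono b c a) = q ^+ b *: wrapy b c.+1 a
    + (q * lam * qint q b)
      *: (lmono b.-1 c a - (q ^+ b.-1 * q^-1 ^+ (c + c)) *: lmono b.-1 c (a + 2)).
Proof.
move=> lt_b lt_c; apply: (lmono_extE _ a lt_b lt_c) => b' c' a'.
by rewrite wrapy_mod lmonoD_mod lmono_mod.
Qed.

Lemma reg_g_iter n b c a : (b < p)%N -> (c < p)%N ->
  iter n reg_g (lmono b c a) = (q ^+ b * q^-1 ^+ c) ^+ n *: lmono b c (a + n).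
Proof.
move=> lt_b lt_c; elim: n => [|n IHn]; first by rewrite scale1r addn0.
by rewrite iterS IHn linearZ /= reg_gE // scalerA -exprSr addnS.
Qed.

Lemma reg_x_iter n c a : (n < p)%N -> (c < p)%N ->
  iter n reg_x (lmono 0 c a) = lmono n c a.
Proof.
move=> + lt_c; elim: n => // n IHn lt_n.
by rewrite iterS IHn ?(ltnW lt_n) // reg_xE ?(ltnW lt_n) // /wrapx lt_n.
Qed.

Lemma reg_y_iter n a : (n < p)%N -> iter n reg_y (lmono 0 0 a) = lmono 0 n a.
Proof.
elim: n => // n IHn lt_n; rewrite iterS IHn ?(ltnW lt_n) //.
rewrite reg_yE ?qord_gt0 ?(ltnW lt_n) // /wrapy lt_n.
by rewrite qint0 mulr0 scale0r addr0 scale1r.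
Qed.

Lemma lmono_iter b c a : (b < p)%N -> (c < p)%N ->
  lmono b c a = iter b reg_x (iter c reg_y (iter a reg_g (lmono 0 0 0))) :> V.
Proof.
move=> lt_b lt_c; rewrite reg_g_iter ?qord_gt0 // expr0 mulr1 expr1n scale1r add0n.
by rewrite reg_y_iter // reg_x_iter.
Qed.

Lemma reg_g_pow b c a : (b < p)%N -> (c < p)%N ->
  iter p reg_g (lmono b c a) = lmono b c (a + p).
Proof.
move=> lt_b lt_c; rewrite reg_g_iter // exprMn exprAC qexp_ord expr1n mul1r.
by rewrite exprAC exprVn qexp_ord invr1 expr1n scale1r.
Qed.

Lemma qexpV_ord : q^-1 ^+ p = 1.
Proof. by rewrite exprVn qexp_ord invr1. Qed.

Lemma reg_g_wrapx b c a : (b <= p)%N -> (c < p)%N ->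
  reg_g (wrapx b c a) = (q ^+ b * q^-1 ^+ c) *: wrapx b c a.+1.
Proof.
rewrite /wrapx leq_eqVlt => /predU1P[->|lt_b] lt_c; last by rewrite lt_b reg_gE.
by rewrite ltnn linearB /= !reg_gE ?qord_gt0 // qexp_ord expr0 scalerBr.
Qed.

Lemma reg_g_wrapy b c a : (b < p)%N -> (c <= p)%N ->
  reg_g (wrapy b c a) = (q ^+ b * q^-1 ^+ c) *: wrapy b c a.+1.
Proof.
move=> lt_b; rewrite /wrapy leq_eqVlt => /predU1P[->|lt_c]; last by rewrite lt_c reg_gE.
by rewrite ltnn linearB /= !reg_gE ?qord_gt0 // qexpV_ord expr0 scalerBr.
Qed.

(** Both exponents may reach p at the same time. *)
Definition wrapxy b c a : V :=
  if (b < p)%N then wrapy b c a else wrapy 0 c (a + p) - wrapy 0 c a.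

Lemma reg_x_wrapy b c a : (b < p)%N -> (c <= p)%N ->
  reg_x (wrapy b c a) = wrapxy b.+1 c a.
Proof.
move=> lt_b; rewrite leq_eqVlt /wrapxy /wrapy => /predU1P[->|lt_c]; last first.
  by rewrite lt_c reg_xE.
by rewrite ltnn linearB /= !reg_xE ?qord_gt0 // /wrapx; case: ifP.
Qed.

(** At b = p the linking term disappears because [p]_q = 0: this is what makes
    the operator of y compatible with the relation for x^p. *)
Lemma reg_y_wrapx b c a : (b <= p)%N -> (c < p)%N ->
  reg_y (wrapx b c a) = q ^+ b *: wrapxy b c.+1 a
    + (q * lam * qint q b)
      *: (lmono b.-1 c a - (q ^+ b.-1 * q^-1 ^+ (c + c)) *: lmono b.-1 c (a + 2)).
Proof.
rewrite /wrapxy /wrapx leq_eqVlt => /predU1P[->|lt_b] lt_c; last first.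
  by rewrite lt_b reg_yE.
rewrite ltnn linearB /= !reg_yE ?qord_gt0 // qint0 qint_ord.
by rewrite !(mulr0, scale0r, addr0) qexp_ord !expr0 !scale1r.
Qed.

Lemma reg_gx v : reg_g (reg_x v) = q *: reg_x (reg_g v).
Proof.
move: v; apply: (@linked_ext _ _ _ _ (reg_g \o reg_x) (q \*: (reg_x \o reg_g))) => b c a lt_b lt_c /=.
by rewrite reg_gE // linearZ /= !reg_xE // reg_g_wrapx // scalerA exprS mulrA.
Qed.

Lemma reg_gy v : reg_g (reg_y v) = q^-1 *: reg_y (reg_g v).
Proof.
move: v; apply: (@linked_ext _ _ _ _ (reg_g \o reg_y) (q^-1 \*: (reg_y \o reg_g))) => b c a lt_b lt_c /=.
have lt_b1 : (b.-1 < p)%N by rewrite (leq_ltn_trans _ lt_b) // leq_pred.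
(* The exponent b - 1 is truncated at b = 0, where [0]_q = 0. *)
have qb_pred : qint q b * q ^+ b.-1 = qint q b * (q^-1 * q ^+ b).
  case: (b) => [|b'] /=; first by rewrite qint0 !mul0r.
  by rewrite exprS mulKf ?qroot_neq0.
rewrite reg_gE // (linearZ_LR reg_y) /= !reg_yE // (linearD reg_g) !(linearZ_LR reg_g).
rewrite (linearB reg_g) (linearZ_LR reg_g) /=.
rewrite reg_g_wrapy // !reg_gE // addSn.
rewrite !scalerDr !scalerN !scalerA; congr (_ *: _ + (_ *: _ - _ *: _)).
- by rewrite exprS; ring.
- by transitivity (q * lam * (qint q b * q ^+ b.-1) * q^-1 ^+ c);
    [ring | rewrite qb_pred; ring].
transitivity (q * lam * (qint q b * q ^+ b.-1) * q^-1 ^+ c * q ^+ b.-1 * q^-1 ^+ (c + c)).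
  by ring.
by rewrite qb_pred; ring.
Qed.

Lemma reg_yx v : reg_y (reg_x v) =
  q *: reg_x (reg_y v) + (q * lam) *: (v - reg_g (reg_g v)).
Proof.
move: v; apply: (@linked_ext _ _ _ _ (reg_y \o reg_x)
  (q \*: (reg_x \o reg_y) \+ (q * lam) \*: (idfun \- (reg_g \o reg_g)))) => b c a lt_b lt_c /=.
have lt_b1 : (b.-1 < p)%N by rewrite (leq_ltn_trans _ lt_b) // leq_pred.
have XK s a1 a2 :
    (q * lam * qint q b) *: (reg_x (lmono b.-1 c a1) - s *: reg_x (lmono b.-1 c a2))
    = (q * lam * qint q b) *: (lmono b c a1 - s *: lmono b c a2).
  case: (b) lt_b => [|b'] lt_b /=; first by rewrite qint0 mulr0 !scale0r.
  by rewrite !reg_xE ?(ltnW lt_b) // /wrapx lt_b.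
rewrite (reg_xE a lt_b lt_c) (reg_y_wrapx a lt_b lt_c) (reg_gE a lt_b lt_c).
rewrite (linearZ_LR reg_g) /= (reg_gE a.+1 lt_b lt_c) (reg_yE a lt_b lt_c).
rewrite (linearD reg_x) !(linearZ_LR reg_x) (linearB reg_x) (linearZ_LR reg_x) /=.
rewrite (reg_x_wrapy a lt_b lt_c) XK !scalerDr !scalerN !scalerA -!addrA -exprS.
congr (_ + _); rewrite addn2 addrA addrACA -opprD -!scalerDl.
congr (_ *: _ - _ *: _); first by rewrite qintSl; ring.
have -> : q^-1 ^+ (c + c) = (q^-1 ^+ c) ^+ 2 by rewrite exprD expr2.
case: (b) => [|b'] /=; first by rewrite qint0 qint1 !expr0; ring.
by rewrite [qint q b'.+2]qintS exprS; ring.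
Qed.

Lemma reg_g_order v : iter (p ^ 2) reg_g v = v.
Proof.
move: v; apply: (@linked_ext _ _ _ _ (iter (p ^ 2) reg_g) idfun) => b c a lt_b lt_c /=.
rewrite reg_g_iter //.
have -> : (q ^+ b * q^-1 ^+ c) ^+ (p ^ 2) = 1.
  rewrite -mulnn exprM exprMn exprAC qexp_ord expr1n mul1r.
  by rewrite [_ ^+ c ^+ p]exprAC qexpV_ord !expr1n.
by rewrite scale1r -lmono_mod modnDr lmono_mod.
Qed.

(** As powers of the same operator commute, it suffices to compare the two sides
    on monomials with b = 0. *)
Lemma reg_x_pow v : iter p reg_x v = iter p reg_g v - v.
Proof.
move: v; apply: (@linked_ext _ _ _ _ (iter p reg_x) (iter p reg_g \- idfun)).
move=> b c a lt_b lt_c /=; rewrite reg_g_pow //.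
rewrite -[in LHS](reg_x_iter a lt_b lt_c) -iterD addnC iterD -[in iter p](prednK (qord_gt0 d)).
rewrite iterS reg_x_iter ?prednK ?qord_gt0 // reg_xE ?prednK ?qord_gt0 //.
by rewrite /wrapx ltnn linearB /= !reg_x_iter.
Qed.

(** By [straighten_ynx], y^p commutes with x, which reduces the claim to powers
    of g. *)
Lemma reg_y_pow v : iter p reg_y v = iter p reg_g v - v.
Proof.
have yp_x b u : iter p reg_y (iter b reg_x u) = iter b reg_x (iter p reg_y u).
  elim: b => //= b IHb; rewrite -IHb.
  rewrite (straighten_ynx qroot_neq0 reg_gy reg_yx).
  by rewrite qint_ord qintV_ord !scale0r subrr scaler0 addr0 qexp_ord scale1r.
move: v; apply: (@linked_ext _ _ _ _ (iter p reg_y) (iter p reg_g \- idfun)).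
move=> b c a lt_b lt_c /=; rewrite reg_g_pow //.
rewrite -[in LHS](reg_x_iter a lt_b lt_c) yp_x -(reg_y_iter a lt_c) -iterD addnC.
rewrite iterD -[in iter p](prednK (qord_gt0 d)).
rewrite iterS reg_y_iter ?prednK ?qord_gt0 // reg_yE ?prednK ?qord_gt0 //.
rewrite qint0 mulr0 scale0r addr0 scale1r.
by rewrite /wrapy ltnn !linearB /= !reg_y_iter // !reg_x_iter.
Qed.

Definition regular_action : linked_action d lam V :=
  LinkedAction reg_g_order reg_gx reg_gy reg_yx reg_x_pow reg_y_pow.

End RegularAction.

Arguments reg_g {k d lam}.
Arguments reg_x {k d lam}.
Arguments reg_y {k d lam}.
Arguments wrapx {k d lam}.
Arguments wrapy {k d lam}.

Section FreeAction.

Variables (k : fieldType) (d : qdatum k) (lam : k).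
Local Notation p := (qord d).
Local Notation q := (qroot d).
Local Notation V := (linked d lam).
Variables (M : lmodType k) (R : linked_action d lam M) (m : M).
Local Notation G := (opg R).
Local Notation X := (opx R).
Local Notation Y := (opy R).

Definition act_mono b c a : M := iter b X (iter c Y (iter a G m)).

Lemma act_mono_mod b c a : act_mono b c (a %% p ^ 2) = act_mono b c a.
Proof.
rewrite /act_mono [in RHS](divn_eq a (p ^ 2)) addnC iterD.
suff -> : iter (a %/ p ^ 2 * p ^ 2) G m = m by [].
by elim: (a %/ _)%N => // n IHn; rewrite mulSn iterD IHn opg_order.
Qed.

(** The map that sends the monomial x^b y^c g^a to the corresponding product of
    operators applied to m.  It intertwines the two actions since monomials are
    straightened by the same rules everywhere. *)
Definition act_on : V -> M := lmono_ext act_mono.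

HB.instance Definition _ := GRing.Linear.on act_on.

Lemma act_on_mono b c a : (b < p)%N -> (c < p)%N ->
  act_on (lmono b c a) = act_mono b c a.
Proof. by move=> ? ?; apply: lmono_extE => // *; apply: act_mono_mod. Qed.

Lemma act_on1 : act_on (lmono 0 0 0) = m.
Proof. by rewrite act_on_mono ?qord_gt0. Qed.

Lemma opg_iter_y n u : iter n G (Y u) = q^-1 ^+ n *: Y (iter n G u).
Proof.
elim: n u => [|n IHn] u; first by rewrite scale1r.
by rewrite iterS IHn linearZ /= opgy scalerA exprSr.
Qed.

Lemma opg_pow_y c u : iter p G (iter c Y u) = iter c Y (iter p G u).
Proof.
by elim: c => //= c IHc; rewrite opg_iter_y qexpV_ord scale1r IHc.
Qed.

Lemma act_on_wrapx b c a : (b <= p)%N -> (c < p)%N ->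
  act_on (wrapx b c a) = act_mono b c a.
Proof.
rewrite /wrapx leq_eqVlt => /predU1P[->|lt_b] lt_c; last by rewrite lt_b act_on_mono.
rewrite ltnn linearB /= !act_on_mono ?qord_gt0 // /act_mono opx_pow opg_pow_y.
by rewrite -iterD addnC.
Qed.

Lemma act_on_wrapy b c a : (b < p)%N -> (c <= p)%N ->
  act_on (wrapy b c a) = act_mono b c a.
Proof.
move=> lt_b; rewrite /wrapy leq_eqVlt => /predU1P[->|lt_c]; last by rewrite lt_c act_on_mono.
rewrite ltnn linearB /= !act_on_mono ?qord_gt0 // /act_mono opy_pow.
by rewrite linearB /= -iterD addnC.
Qed.

Lemma act_on_g v : act_on (reg_g v) = G (act_on v).
Proof.
move: v; apply: (@linked_ext _ _ _ _ (act_on \o reg_g) (G \o act_on)) => b c a lt_b lt_c /=.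
rewrite reg_gE // linearZ /= !act_on_mono // /act_mono (twist_iter (opgx R)).
by rewrite (twist_iter (opgy R)) linearZ /= scalerA.
Qed.

Lemma act_on_x v : act_on (reg_x v) = X (act_on v).
Proof.
move: v; apply: (@linked_ext _ _ _ _ (act_on \o reg_x) (X \o act_on)) => b c a lt_b lt_c /=.
by rewrite reg_xE // act_on_wrapx // act_on_mono.
Qed.

Lemma act_on_y v : act_on (reg_y v) = Y (act_on v).
Proof.
move: v; apply: (@linked_ext _ _ _ _ (act_on \o reg_y) (Y \o act_on)) => b c a lt_b lt_c /=.
have lt_b1 : (b.-1 < p)%N by rewrite (leq_ltn_trans _ lt_b) // leq_pred.
rewrite reg_yE // (linearD act_on) !(linearZ_LR act_on) (linearB act_on).
rewrite (linearZ_LR act_on) /= act_on_wrapy // !act_on_mono //.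
rewrite /act_mono (straighten_yxn (opgx R) (opyx R)) -iterS; congr (_ + _ *: (_ - _)).
rewrite !(twist_iter (opgy R)) linearZ /= (twist_iter (opgy R)) !linearZ /= !scalerA.
by rewrite -!iterS addn2 exprD mulrC.
Qed.

End FreeAction.

(** * The algebra structure *)

Section Generation.

Variables (k : fieldType) (d : qdatum k) (lam : k).
Local Notation V := (linked d lam).

(** Every basis monomial is obtained from 1 by applying the three operators. *)
Lemma linked_ind (P : V -> Prop) :
    (forall a u v, P u -> P v -> P (a *: u + v)) -> P (lmono 0 0 0) ->
    (forall v, P v -> P (reg_g v)) -> (forall v, P v -> P (reg_x v)) ->
    (forall v, P v -> P (reg_y v)) ->
  forall v, P v.
Proof.
move=> Plin P1 Pg Px Py v.
have P0 : P 0 by rewrite -(addNr (lmono 0 0 0 : V)) -scaleN1r; apply: Plin.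
have Piter f n u : (forall w, P w -> P (f w)) -> P u -> P (iter n f u).
  by move=> Pf Pu; elim: n => //= n IHn; apply: Pf.
rewrite [v]lmono_sum; elim/big_rec: _ => // i u _ Pu; apply: Plin => //.
by rewrite lmono_iter //; do 3!apply: (Piter _ _ _) => //.
Qed.

Lemma linked_ext_gen (M : lmodType k) (f h : {linear V -> M}) :
    f (lmono 0 0 0) = h (lmono 0 0 0) ->
    (forall v, f v = h v -> f (reg_g v) = h (reg_g v)) ->
    (forall v, f v = h v -> f (reg_x v) = h (reg_x v)) ->
    (forall v, f v = h v -> f (reg_y v) = h (reg_y v)) ->
  f =1 h.
Proof.
by move=> ? ? ? ?; apply: linked_ind => // a u v; rewrite !linearP => -> ->.
Qed.

Lemma act_on_unique (M : lmodType k) (R : linked_action d lam M) (f h : {linear V -> M}) :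
    f (lmono 0 0 0) = h (lmono 0 0 0) ->
    (forall v, f (reg_g v) = opg R (f v)) -> (forall v, h (reg_g v) = opg R (h v)) ->
    (forall v, f (reg_x v) = opx R (f v)) -> (forall v, h (reg_x v) = opx R (h v)) ->
    (forall v, f (reg_y v) = opy R (f v)) -> (forall v, h (reg_y v) = opy R (h v)) ->
  f =1 h.
Proof.
move=> fh1 fg hg fx hx fy hy.
by apply: linked_ext_gen => // v fh; rewrite ?(fg, hg, fx, hx, fy, hy) fh.
Qed.

End Generation.

Section LinkedAlgebra.

Variables (k : fieldType) (d : qdatum k) (lam : k).
Local Notation p := (qord d).
Local Notation q := (qroot d).
Local Notation V := (linked d lam).
Local Notation R := (regular_action d lam).

(** The product u v is the value at u of the intertwining map sending 1 to v. *)
Definition lmul (u v : V) : V := act_on R v u.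
Definition lone : V := lmono 0 0 0.

Lemma lmul_linear_r u : linear (lmul u).
Proof.
move=> a v w; rewrite /lmul /act_on /lmono_ext scaler_sumr -big_split.
apply: eq_bigr => i _ /=; rewrite scalerA mulrC -scalerA -scalerDr; congr (_ *: _).
by rewrite /act_mono /= !linearP.
Qed.

Lemma lmul1 : left_id lone lmul.
Proof. by move=> v; apply: act_on1. Qed.

Lemma lmulg u v : lmul (reg_g u) v = reg_g (lmul u v).
Proof. exact: act_on_g. Qed.
Lemma lmulx u v : lmul (reg_x u) v = reg_x (lmul u v).
Proof. exact: act_on_x. Qed.
Lemma lmuly u v : lmul (reg_y u) v = reg_y (lmul u v).
Proof. exact: act_on_y. Qed.

Lemma lmulr1 : right_id lone lmul.
Proof.
apply: (@act_on_unique _ _ _ _ R (act_on R lone) idfun) => //= *;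
  rewrite ?(act_on_g, act_on_x, act_on_y) //; exact: act_on1.
Qed.

(** Both sides intertwine in u and agree at u = 1. *)
Lemma lmulA : associative lmul.
Proof.
move=> u v w; move: u.
apply: (@act_on_unique _ _ _ _ R (act_on R (lmul v w)) (act_on R w \o act_on R v));
  move=> * /=; rewrite ?(act_on_g, act_on_x, act_on_y) //.
by rewrite -![act_on R _ _]/(lmul _ _) !lmul1.
Qed.

Lemma lmulDl : left_distributive lmul +%R.
Proof. by move=> u v w; exact: linearD. Qed.

Lemma lmulDr : right_distributive lmul +%R.
Proof. by move=> u v w; rewrite -[v]scale1r lmul_linear_r !scale1r. Qed.

Lemma lone_neq0 : lone != 0.
Proof.
have p2 := sqr_qord_gt0 d; have p1 := qord_gt0 d.
apply/eqP => /ffunP/(_ (Ordinal p1, Ordinal p1, Ordinal p2)).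
by rewrite !ffunE /= mod0n => /eqP; rewrite oner_eq0.
Qed.

HB.instance Definition _ := GRing.Zmodule_isNzRing.Build V
  lmulA lmul1 lmulr1 lmulDl lmulDr lone_neq0.

Lemma lmul_scaleAl (a : k) (u v : V) : a *: (u * v) = (a *: u) * v.
Proof. by symmetry; apply: (linearZ_LR (act_on R v)). Qed.

HB.instance Definition _ := GRing.Lmodule_isLalgebra.Build k V lmul_scaleAl.

Lemma lmul_scaleAr (a : k) (u v : V) : a *: (u * v) = u * (a *: v).
Proof.
rewrite -[in RHS](addr0 (a *: v)) [RHS]lmul_linear_r.
by rewrite -[X in _ = _ + X]/(u * 0) mulr0 addr0.
Qed.

HB.instance Definition _ := GRing.Lalgebra_isAlgebra.Build k V lmul_scaleAr.
HB.instance Definition _ := Algebra_isFalgebra.Build k V.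

Definition lg : V := lmono 0 0 1.
Definition lx : V := lmono 1 0 0.
Definition ly : V := lmono 0 1 0.

Lemma reg_gM v : reg_g v = lg * v.
Proof.
have -> : lg = reg_g 1 by rewrite reg_gE ?qord_gt0 // mulr1 scale1r.
by rewrite -[RHS]/(lmul _ _) lmulg [lmul 1 v]lmul1.
Qed.

Lemma reg_xM v : reg_x v = lx * v.
Proof.
have -> : lx = reg_x 1 by rewrite reg_xE ?qord_gt0 // /wrapx qord_gt1.
by rewrite -[RHS]/(lmul _ _) lmulx [lmul 1 v]lmul1.
Qed.

Lemma reg_yM v : reg_y v = ly * v.
Proof.
have -> : ly = reg_y 1.
  by rewrite /ly -(reg_y_iter lam 0 (qord_gt1 d)).
by rewrite -[RHS]/(lmul _ _) lmuly [lmul 1 v]lmul1.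
Qed.

End LinkedAlgebra.

(** An algebra with coordinates in which the generators act by the regular
    action.  Such an algebra is isomorphic to H(lam); arguing about an arbitrary
    one keeps the explicit construction out of the later proofs. *)
Record linked_model (k : fieldType) (d : qdatum k) (lam : k) (H : falgType k) :=
  LinkedModel {
    gen_g : H;
    gen_x : H;
    gen_y : H;
    coords : {linear H -> linked d lam};
    coords_inj : injective coords;
    coords1 : coords 1 = lmono 0 0 0;
    coords_g h : coords (gen_g * h) = reg_g (coords h);
    coords_x h : coords (gen_x * h) = reg_x (coords h);
    coords_y h : coords (gen_y * h) = reg_y (coords h)
  }.

Definition standard_model (k : fieldType) (d : qdatum k) (lam : k) :
    linked_model d lam (linked d lam) :=
  @LinkedModel k d lam (linked d lam) (lg d lam) (lx d lam) (ly d lam) idfun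
    (fun _ _ => id) erefl (fun v => esym (reg_gM v)) (fun v => esym (reg_xM v))
    (fun v => esym (reg_yM v)).

Section ModelTheory.

Variables (k : fieldType) (d : qdatum k) (lam : k) (H : falgType k).
Variable (L : linked_model d lam H).
Local Notation p := (qord d).
Local Notation q := (qroot d).
Local Notation g := (gen_g L).
Local Notation x := (gen_x L).
Local Notation y := (gen_y L).

Lemma coords_expr (a : H) f :
    (forall h, coords L (a * h) = f (coords L h)) ->
  forall n h, coords L (a ^+ n * h) = iter n f (coords L h).
Proof.
move=> af n h; elim: n => [|n IHn]; first by rewrite mul1r.
by rewrite exprS -mulrA af IHn.
Qed.

Definition coords_gX := coords_expr (coords_g L).
Definition coords_xX := coords_expr (coords_x L).
Definition coords_yX := coords_expr (coords_y L).

Lemma coords_mono b c a : (b < p)%N -> (c < p)%N ->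
  coords L (x ^+ b * y ^+ c * g ^+ a) = lmono b c a.
Proof.
move=> lt_b lt_c; rewrite -mulrA -[g ^+ a]mulr1 coords_xX coords_yX coords_gX.
by rewrite coords1 -lmono_iter.
Qed.

Lemma gen_order : g ^+ (p ^ 2) = 1.
Proof. by apply: (@coords_inj _ _ _ _ L); rewrite -[g ^+ _]mulr1 coords_gX reg_g_order. Qed.

Lemma gen_gx : g * x = q *: (x * g).
Proof.
apply: (@coords_inj _ _ _ _ L); rewrite linearZ /= -[g * x]mulr1 -[x * g]mulr1 -!mulrA.
by rewrite !(coords_g, coords_x) reg_gx.
Qed.

Lemma gen_gy : g * y = q^-1 *: (y * g).
Proof.
apply: (@coords_inj _ _ _ _ L); rewrite linearZ /= -[g * y]mulr1 -[y * g]mulr1 -!mulrA.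
by rewrite !(coords_g, coords_y) reg_gy.
Qed.

Lemma gen_yx : y * x = q *: (x * y) + (q * lam) *: (1 - g ^+ 2).
Proof.
apply: (@coords_inj _ _ _ _ L); rewrite linearD !linearZ linearB /=.
rewrite -[y * x]mulr1 -[x * y]mulr1 -!mulrA -[g ^+ 2]mulr1.
by rewrite !(coords_x, coords_y, coords_gX) coords1 reg_yx.
Qed.

Lemma gen_x_pow : x ^+ p = g ^+ p - 1.
Proof.
apply: (@coords_inj _ _ _ _ L); rewrite linearB /=.
by rewrite -[x ^+ _]mulr1 -[g ^+ _]mulr1 coords_xX coords_gX coords1 reg_x_pow.
Qed.

Lemma gen_y_pow : y ^+ p = g ^+ p - 1.
Proof.
apply: (@coords_inj _ _ _ _ L); rewrite linearB /=.
by rewrite -[y ^+ _]mulr1 -[g ^+ _]mulr1 coords_yX coords_gX coords1 reg_y_pow.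
Qed.

Lemma coords_sum h :
  h = \sum_(i : 'I_p * 'I_p * 'I_(p ^ 2)) (coords L h i : k)
        *: (x ^+ i.1.1 * y ^+ i.1.2 * g ^+ i.2).
Proof.
apply: (@coords_inj _ _ _ _ L); rewrite linear_sum [LHS]lmono_sum.
by apply: eq_bigr => i _; rewrite linearZ /= coords_mono.
Qed.

(** The induction principle behind all the Hopf axioms. *)
Lemma gen_ind (P : H -> Prop) :
    (forall a u v, P u -> P v -> P (a *: u + v)) -> P 1 ->
    (forall v, P v -> P (g * v)) -> (forall v, P v -> P (x * v)) ->
    (forall v, P v -> P (y * v)) ->
  forall v, P v.
Proof.
move=> Plin P1 Pg Px Py v.
have P0 : P 0 by rewrite -(addNr 1) -scaleN1r; apply: Plin.
have PX a n u : (forall w, P w -> P (a * w)) -> P u -> P (a ^+ n * u).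
  by move=> Pa Pu; elim: n => [|n IHn]; rewrite ?mul1r // exprS -mulrA; apply: Pa.
rewrite [v]coords_sum; elim/big_rec: _ => // i u _ Pu; apply: Plin => //.
by rewrite -mulrA -[g ^+ _]mulr1; do 3!apply: (PX _ _ _) => //.
Qed.

Lemma gen_ext (M : lmodType k) (f h : {linear H -> M}) :
    f 1 = h 1 ->
    (forall v, f v = h v -> f (g * v) = h (g * v)) ->
    (forall v, f v = h v -> f (x * v) = h (x * v)) ->
    (forall v, f v = h v -> f (y * v) = h (y * v)) ->
  f =1 h.
Proof.
by move=> ? ? ? ?; apply: gen_ind => // a u v; rewrite !linearP => -> ->.
Qed.

Section Recursor.

Variables (M : lmodType k) (R : linked_action d lam M) (m : M).

(** The universal property: a module and a point of it determine a linear map. *)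
Definition gen_rec : H -> M := act_on R m \o coords L.

HB.instance Definition _ := GRing.Linear.on gen_rec.

Lemma gen_rec1 : gen_rec 1 = m.
Proof. by rewrite /gen_rec /= coords1 act_on1. Qed.
Lemma gen_rec_g h : gen_rec (g * h) = opg R (gen_rec h).
Proof. by rewrite /gen_rec /= coords_g act_on_g. Qed.
Lemma gen_rec_x h : gen_rec (x * h) = opx R (gen_rec h).
Proof. by rewrite /gen_rec /= coords_x act_on_x. Qed.
Lemma gen_rec_y h : gen_rec (y * h) = opy R (gen_rec h).
Proof. by rewrite /gen_rec /= coords_y act_on_y. Qed.

End Recursor.

End ModelTheory.

Arguments gen_ind {k d lam H} L.
Arguments gen_ext {k d lam H} L {M}.

(** * Linear maps on tensor products *)

Section TensorMaps.

Variables (k : fieldType).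
Implicit Types V W : vectType k.

Lemma tensDl V W (v v' : V) (w : W) : (v + v') *t w = v *t w + v' *t w.
Proof. by apply/matrixP=> i j; rewrite !mxE linearD mulrDl. Qed.

Lemma tensDr V W (v : V) (w w' : W) : v *t (w + w') = v *t w + v *t w'.
Proof. by apply/matrixP=> i j; rewrite !mxE linearD mulrDr. Qed.

Lemma tensZl V W a (v : V) (w : W) : (a *: v) *t w = a *: (v *t w).
Proof. by apply/matrixP=> i j; rewrite !mxE linearZ mulrA. Qed.

Lemma tensZr V W a (v : V) (w : W) : v *t (a *: w) = a *: (v *t w).
Proof. by apply/matrixP=> i j; rewrite !mxE linearZ mulrCA. Qed.

Lemma tens0l V W (w : W) : (0 : V) *t w = 0.
Proof. by rewrite -(scale0r 0) tensZl scale0r. Qed.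

Lemma tens0r V W (v : V) : v *t (0 : W) = 0.
Proof. by rewrite -(scale0r 0) tensZr scale0r. Qed.

Lemma tensBl V W (v v' : V) (w : W) : (v - v') *t w = v *t w - v' *t w.
Proof. by rewrite tensDl -scaleN1r tensZl scaleN1r. Qed.

Lemma tensBr V W (v : V) (w w' : W) : v *t (w - w') = v *t w - v *t w'.
Proof. by rewrite tensDr -scaleN1r tensZr scaleN1r. Qed.

HB.instance Definition _ V W (U : lmodType k) (B : V -> W -> U) :=
  GRing.isLinear.Build k (tensor V W) U _ (tlift B) (tliftP B).
HB.instance Definition _ V V' W W' (f : V -> V') (g : W -> W') :=
  GRing.isLinear.Build k (tensor V W) (tensor V' W') _ (tens_map f g) (tliftP _).
HB.instance Definition _ V W U :=
  GRing.isLinear.Build k (tensor (tensor V W) U) (tensor V (tensor W U)) _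
    (@tens_assoc k V W U) (tliftP _).

Lemma tens_ext V W (U : lmodType k) (f h : {linear tensor V W -> U}) :
  (forall v w, f (v *t w) = h (v *t w)) -> f =1 h.
Proof.
move=> eq_fh t; rewrite [t]tensor_span !linear_sum; apply: eq_bigr => i _.
rewrite !linear_sum; apply: eq_bigr => j _.
by rewrite !linearZ /= eq_fh.
Qed.

Lemma tens_mapE V V' W W' (f : {linear V -> V'}) (g : {linear W -> W'}) v w :
  tens_map f g (v *t w) = f v *t g w.
Proof.
by apply: tliftE => [w'|v'] a x y; rewrite linearP (tensDl, tensDr) (tensZl, tensZr).
Qed.

Lemma eq_tlift V W (U : lmodType k) (B B' : V -> W -> U) :
  (forall v w, B v w = B' v w) -> tlift B =1 tlift B'.
Proof.
by move=> eqB t; do 2!(apply: eq_bigr => ? _); rewrite eqB.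
Qed.

Lemma tlift_comb V W (U : lmodType k) a (B B' : V -> W -> U) t :
  tlift (fun v w => a *: B v w + B' v w) t = a *: tlift B t + tlift B' t.
Proof.
rewrite /tlift scaler_sumr -big_split; apply: eq_bigr => i _ /=.
rewrite scaler_sumr -big_split; apply: eq_bigr => j _ /=.
by rewrite scalerDr !scalerA mulrC.
Qed.

Lemma tens_assocE V W (U : vectType k) (v : V) (w : W) (u : U) :
  tens_assoc ((v *t w) *t u) = v *t (w *t u).
Proof.
rewrite /tens_assoc tliftE => [|u' a x y|t a x y]; last 2 first.
- exact: linearP.
- by rewrite -tlift_comb; apply: eq_tlift => v' w'; rewrite !(tensDr, tensZr).
by rewrite tliftE // => w' a x y; rewrite ?(tensDl, tensDr, tensZl, tensZr).
Qed.

End TensorMaps.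

Lemma tens_ind (k : fieldType) (V W : vectType k) (P : tensor V W -> Prop) :
    (forall a s t, P s -> P t -> P (a *: s + t)) -> (forall v w, P (v *t w)) ->
  forall t, P t.
Proof.
move=> Plin Ppure t; rewrite [t]tensor_span /tlift.
have P0 : P 0 by rewrite -(tens0l _ (0 : W)).
elim/big_rec: _ => // i u _ Pu; rewrite -[X in X + u]scale1r; apply: (Plin _ _ _) => //.
by elim/big_rec: _ => // j w _ Pw; apply: (Plin _ _ _).
Qed.

Section TensorProductAlgebra.

Variables (k : fieldType).

Fact mull_linear (A : falgType k) (a : A) : linear ( *%R a).
Proof. by move=> c u v; rewrite mulrDr scalerAr. Qed.

HB.instance Definition _ (A : falgType k) (a : A) :=
  GRing.isLinear.Build k A A _ ( *%R a) (mull_linear a).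

Fact mulr_linear (A : falgType k) (a : A) : linear ( *%R^~ a).
Proof. by move=> c u v; rewrite mulrDl scalerAl. Qed.

Variables (A B : falgType k).

Lemma tens_mul_pure (a : A) (b : B) t :
  tens_mul (a *t b) t = tens_map ( *%R a) ( *%R b) t.
Proof.
rewrite /tens_mul tliftE // => [b'|a'] c x y; rewrite -tlift_comb;
  by apply: eq_tlift => u v; rewrite ?(mulrDl, tensDl, tensDr) -?scalerAl (tensZl, tensZr).
Qed.

Lemma tens_mul_linear (t : tensor A B) : linear (fun s => tens_mul s t).
Proof. by move=> c u v; rewrite /tens_mul linearP. Qed.

End TensorProductAlgebra.

(** * The coproduct *)

Section HopfStructure.

Variables (k : fieldType) (d : qdatum k) (lam : k) (H : falgType k).
Variable (L : linked_model d lam H).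
Local Notation p := (qord d).
Local Notation q := (qroot d).
Local Notation g := (gen_g L).
Local Notation x := (gen_x L).
Local Notation y := (gen_y L).

(** Left multiplications by g *t g and, in [skewprim], by z *t 1 + g *t z. *)
Definition diag : tensor H H -> tensor H H := tens_map ( *%R g) ( *%R g).
Definition skewl (z : H) : tensor H H -> tensor H H := tens_map ( *%R z) idfun.
Definition skewr (z : H) : tensor H H -> tensor H H := tens_map ( *%R g) ( *%R z).
Definition skewprim (z : H) (t : tensor H H) : tensor H H := skewl z t + skewr z t.

HB.instance Definition _ := GRing.Linear.on diag.
HB.instance Definition _ z := GRing.Linear.on (skewl z).
HB.instance Definition _ z := GRing.Linear.on (skewr z).

Fact skewprim_linear z : linear (skewprim z).
Proof. exact: (linearP (skewl z \+ skewr z)). Qed.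

HB.instance Definition _ z :=
  GRing.isLinear.Build k (tensor H H) (tensor H H) _ (skewprim z) (skewprim_linear z).

Lemma diagE a b : diag (a *t b) = (g * a) *t (g * b).
Proof. exact: tens_mapE. Qed.
Lemma skewlE z a b : skewl z (a *t b) = (z * a) *t b.
Proof. exact: tens_mapE. Qed.
Lemma skewrE z a b : skewr z (a *t b) = (g * a) *t (z * b).
Proof. exact: tens_mapE. Qed.
Lemma skewprimE z a b : skewprim z (a *t b) = (z * a) *t b + (g * a) *t (z * b).
Proof. by rewrite /skewprim skewlE skewrE. Qed.

Lemma diag_iter n a b : iter n diag (a *t b) = (g ^+ n * a) *t (g ^+ n * b).
Proof.
elim: n => [|n IHn]; first by rewrite !mul1r.
by rewrite iterS IHn diagE !mulrA -!exprS.
Qed.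

Lemma skewl_iter z n a b : iter n (skewl z) (a *t b) = (z ^+ n * a) *t b.
Proof.
elim: n => [|n IHn]; first by rewrite !mul1r.
by rewrite iterS IHn skewlE !mulrA -!exprS.
Qed.

Lemma skewr_iter z n a b :
  iter n (skewr z) (a *t b) = (g ^+ n * a) *t (z ^+ n * b).
Proof.
elim: n => [|n IHn]; first by rewrite !mul1r.
by rewrite iterS IHn skewrE !mulrA -!exprS.
Qed.

Lemma diag_order t : iter (p ^ 2) diag t = t.
Proof.
move: t; apply: (@tens_ext _ _ _ _ (iter (p ^ 2) diag) idfun) => a b /=.
by rewrite diag_iter gen_order !mul1r.
Qed.

Lemma diag_skew z c : g * z = c *: (z * g) ->
  forall t, diag (skewprim z t) = c *: skewprim z (diag t).
Proof.
move=> gz; apply: (@tens_ext _ _ _ _ (diag \o skewprim z) (c \*: (skewprim z \o diag))) => a b /=.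
rewrite !(skewprimE, diagE) (linearD diag) /= !diagE !mulrA gz.
by rewrite -!scalerAl tensZl tensZr scalerDr.
Qed.

Lemma skewrl z c : g * z = c *: (z * g) ->
  forall t, skewr z (skewl z t) = c *: skewl z (skewr z t).
Proof.
move=> gz; apply: (@tens_ext _ _ _ _ (skewr z \o skewl z) (c \*: (skewl z \o skewr z))).
by move=> a b /=; rewrite !(skewrE, skewlE) !mulrA gz -!scalerAl tensZl.
Qed.

(** The operators [skewl z] and [skewr z] commute up to the primitive root c, so
    that the p-th power of their sum is the sum of their p-th powers. *)
Lemma skew_pow z c : g * z = c *: (z * g) -> p.-primitive_root c ->
  z ^+ p = g ^+ p - 1 -> forall t, iter p (skewprim z) t = iter p diag t - t.
Proof.
move=> gz c_prim zp t; rewrite (qbinomial_prim (skewrl gz)) ?qord_gt1 //.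
move: t; apply: (@tens_ext _ _ _ _ (iter p (skewl z) \+ iter p (skewr z))
  (iter p diag \- idfun)) => a b /=.
rewrite skewl_iter skewr_iter diag_iter zp !mulrBl !mul1r tensBl tensBr.
by rewrite addrC subrKA.
Qed.

(** The mixed terms cancel because g commutes with x and y up to inverse factors;
    the linking terms (1 - g^2) *t 1 and g^2 *t (1 - g^2) add up to
    1 *t 1 - g^2 *t g^2. *)
Lemma skew_yx t :
  skewprim y (skewprim x t) = q *: skewprim x (skewprim y t) + (q * lam) *: (t - diag (diag t)).
Proof.
move: t; apply: (@tens_ext _ _ _ _ (skewprim y \o skewprim x)
  (q \*: (skewprim x \o skewprim y) \+ (q * lam) \*: (idfun \- (diag \o diag)))) => a b /=.
rewrite (skewprimE x a) (skewprimE y a) (diagE a) (linearD (skewprim y)) (linearD (skewprim x)) /=.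
rewrite (skewprimE y) (skewprimE y) (skewprimE x) (skewprimE x) diagE !mulrA.
rewrite gen_gx gen_gy gen_yx.
rewrite !mulrDl -!scalerAl !mulrBl !mul1r.
rewrite !tensDl !tensDr !tensZl !tensZr !tensBl !tensBr.
rewrite -expr2 !scalerDr !scalerA mulfV ?qroot_neq0 // scale1r.
rewrite [LHS](AC (2*1*(1*2)) ((1*4)*(3*5)*(2*6))) /=; congr (_ + _).
by rewrite -!scalerDr addrA subrK.
Qed.

Definition tensor_action : linked_action d lam (tensor H H) :=
  LinkedAction diag_order (diag_skew (gen_gx L)) (diag_skew (gen_gy L)) skew_yx
    (skew_pow (gen_gx L) (qroot_prim d) (gen_x_pow L))
    (skew_pow (gen_gy L) (qrootV_prim d) (gen_y_pow L)).

Definition lcomul : H -> tensor H H := gen_rec L tensor_action (1 *t 1).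

HB.instance Definition _ := GRing.Linear.on lcomul.

Lemma lcomul1 : lcomul 1 = 1 *t 1.
Proof. exact: gen_rec1. Qed.
Lemma lcomul_g v : lcomul (g * v) = diag (lcomul v).
Proof. exact: gen_rec_g. Qed.
Lemma lcomul_x v : lcomul (x * v) = skewprim x (lcomul v).
Proof. exact: gen_rec_x. Qed.
Lemma lcomul_y v : lcomul (y * v) = skewprim y (lcomul v).
Proof. exact: gen_rec_y. Qed.

End HopfStructure.

(** * Counit, antipode and the Hopf axioms *)

Section HopfLaws.

Variables (k : fieldType) (d : qdatum k) (lam : k) (H : falgType k).
Variable (L : linked_model d lam H).
Local Notation p := (qord d).
Local Notation q := (qroot d).
Local Notation g := (gen_g L).
Local Notation x := (gen_x L).
Local Notation y := (gen_y L).
Local Notation D := (lcomul L).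

Lemma gen_g_unit : g \is a GRing.unit.
Proof.
by rewrite -(unitrX_pos g (sqr_qord_gt0 d)) gen_order unitr1.
Qed.

Lemma gen_skew_inv z c : g * z = c *: (z * g) -> z * g^-1 = c *: (g^-1 * z).
Proof.
move=> gz; apply: (mulrI gen_g_unit); rewrite mulrA gz -scalerAl mulrK ?gen_g_unit //.
by rewrite -scalerAr mulVKr ?gen_g_unit.
Qed.

Lemma gen_skew_inv_pow z c n : g * z = c *: (z * g) ->
  (g^-1 * z) ^+ n = c ^+ 'C(n, 2) *: (g^-1 ^+ n * z ^+ n).
Proof.
move=> gz; have zgn m : z * g^-1 ^+ m = c ^+ m *: (g^-1 ^+ m * z).
  elim: m => [|m IHm]; first by rewrite mulr1 mul1r scale1r.
  rewrite [in LHS]exprSr mulrA IHm -scalerAl -[_ * z * _]mulrA (gen_skew_inv gz).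
  by rewrite -scalerAr scalerA -exprSr mulrA -exprSr.
elim: n => [|n IHn]; first by rewrite mulr1 scale1r.
rewrite exprS IHn binS bin1 exprD -scalerAr -!scalerA; congr (_ *: _).
by rewrite mulrA -[g^-1 * z * _]mulrA zgn -scalerAr -scalerAl mulrA -exprS -mulrA -exprS.
Qed.

(** Collecting the inverses of g produces c to the power p (p - 1) / 2, which is 1
    because p is odd; oddness also decides the sign. *)
Lemma gen_antipode_pow z c : g * z = c *: (z * g) -> c ^+ p = 1 ->
  z ^+ p = g ^+ p - 1 -> (- (g^-1 * z)) ^+ p = g^-1 ^+ p - 1.
Proof.
move=> gz cp zp; rewrite exprNn -signr_odd qord_odd expr1 mulN1r (gen_skew_inv_pow _ gz).
rewrite bin2odd ?qord_odd // exprM cp expr1n scale1r zp mulrBr mulr1 opprB.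
by rewrite -exprMn_comm ?mulVr ?expr1n ?gen_g_unit //; apply: commr_sym; apply: commrV.
Qed.

Definition rmul (z h : H) : H := h * z.

Fact rmul_linear z : linear (rmul z).
Proof. exact: mulr_linear. Qed.

HB.instance Definition _ z := GRing.isLinear.Build k H H _ (rmul z) (rmul_linear z).

Lemma rmul_iter z n h : iter n (rmul z) h = h * z ^+ n.
Proof. by elim: n => [|n IHn]; rewrite ?mulr1 // iterS IHn /rmul -mulrA -exprSr. Qed.

Fact rmul_order h : iter (p ^ 2) (rmul g^-1) h = h.
Proof. by rewrite rmul_iter exprVn gen_order invr1 mulr1. Qed.

Fact rmul_skew z c : g * z = c *: (z * g) -> forall h,
  rmul g^-1 (rmul (- (g^-1 * z)) h) = c *: rmul (- (g^-1 * z)) (rmul g^-1 h).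
Proof.
move=> gz h; rewrite /rmul !mulrN mulNr scalerN -!mulrA (gen_skew_inv gz).
by rewrite -!scalerAr.
Qed.

Fact rmul_pow z c : g * z = c *: (z * g) -> c ^+ p = 1 -> z ^+ p = g ^+ p - 1 ->
  forall h, iter p (rmul (- (g^-1 * z))) h = iter p (rmul g^-1) h - h.
Proof.
by move=> gz cp zp h; rewrite !rmul_iter (gen_antipode_pow gz) // mulrBr mulr1.
Qed.

Fact rmul_yx h :
  rmul (- (g^-1 * y)) (rmul (- (g^-1 * x)) h)
    = q *: rmul (- (g^-1 * x)) (rmul (- (g^-1 * y)) h)
      + (q * lam) *: (h - rmul g^-1 (rmul g^-1 h)).
Proof.
have prodE z1 z2 c : g * z1 = c *: (z1 * g) ->
    g^-1 * z1 * (g^-1 * z2) = c *: (g^-1 * g^-1 * (z1 * z2)).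
  move=> gz1; rewrite -mulrA [z1 * (_ * _)]mulrA (gen_skew_inv gz1).
  by rewrite -scalerAl -scalerAr !mulrA.
rewrite /rmul !(mulrN, mulNr) !opprK -[h * (g^-1 * x) * _]mulrA.
rewrite -[h * (g^-1 * y) * _]mulrA -[h * g^-1 * _]mulrA.
rewrite (prodE _ _ _ (gen_gx L)) (prodE _ _ _ (gen_gy L)) gen_yx.
rewrite -!scalerAr scalerA mulfV ?qroot_neq0 // scale1r !mulrDr -!scalerAr -addrA.
rewrite -scalerDr [X in _ = _ + _ *: X]addrC -[X in X - _](mulr1 h) -!mulrBr -mulrDr.
suff -> : 1 - g^-1 / g + g^-1 / g * (1 - g ^+ 2) = 0 by rewrite mulr0 scaler0 addr0.
rewrite mulrBr mulr1 expr2 mulrA divrK ?gen_g_unit // mulVr ?gen_g_unit //.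
by rewrite subrKA subrr.
Qed.

(** Right multiplications by the images of the generators, since the antipode
    reverses products. *)
Definition antipode_action : linked_action d lam H :=
  LinkedAction rmul_order (rmul_skew (gen_gx L)) (rmul_skew (gen_gy L)) rmul_yx
    (rmul_pow (gen_gx L) (qexp_ord d) (gen_x_pow L))
    (rmul_pow (gen_gy L) (qexpV_ord d) (gen_y_pow L)).

Definition lantipode : H -> H := gen_rec L antipode_action 1.

HB.instance Definition _ := GRing.Linear.on lantipode.

Local Notation S := lantipode.

Lemma lantipode1 : S 1 = 1.
Proof. exact: gen_rec1. Qed.
Lemma lantipode_g h : S (g * h) = S h * g^-1.
Proof. exact: gen_rec_g. Qed.
Lemma lantipode_x h : S (x * h) = - (S h * (g^-1 * x)).
Proof. by rewrite -mulrN; apply: gen_rec_x. Qed.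
Lemma lantipode_y h : S (y * h) = - (S h * (g^-1 * y)).
Proof. by rewrite -mulrN; apply: gen_rec_y. Qed.

Lemma zero_iter (M : lmodType k) n (m : M) : (0 < n)%N -> iter n (fun => 0) m = 0.
Proof. by case: n. Qed.

Lemma id_iter (T : Type) n (m : T) : iter n (fun u => u) m = m.
Proof. by elim: n => //= n ->. Qed.

Definition counit_action : linked_action d lam k^o.
Proof.
apply: (@LinkedAction _ _ _ _ idfun \0 \0) => m /=.
- by rewrite id_iter.
- by rewrite scaler0.
- by rewrite scaler0.
- by rewrite subrr !scaler0 addr0.
- by rewrite zero_iter ?qord_gt0 // id_iter subrr.
- by rewrite zero_iter ?qord_gt0 // id_iter subrr.
Defined.

Definition lcounit : H -> k^o := gen_rec L counit_action 1.

HB.instance Definition _ := GRing.Linear.on lcounit.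

Local Notation e := lcounit.

Lemma lcounit1 : e 1 = 1.
Proof. exact: gen_rec1. Qed.
Lemma lcounit_g h : e (g * h) = e h.
Proof. exact: gen_rec_g. Qed.
Lemma lcounit_x h : e (x * h) = 0.
Proof. exact: gen_rec_x. Qed.
Lemma lcounit_y h : e (y * h) = 0.
Proof. exact: gen_rec_y. Qed.

Lemma tlift_counitl (a b : H) : tlift (fun u v => e u *: v) (a *t b) = e a *: b.
Proof.
by apply: tliftE => [w|v] c u u'; rewrite linearP ?scalerDl ?scalerDr ?scalerA // mulrC.
Qed.

Lemma tlift_counitr (a b : H) : tlift (fun u v => e v *: u) (a *t b) = e b *: a.
Proof.
by apply: tliftE => [w|v] c u u'; rewrite linearP ?scalerDl ?scalerDr ?scalerA // mulrC.
Qed.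

Lemma lcomul_counital : counital D e.
Proof.
move=> h; split; move: h.
- have Pg t : tlift (fun u v => e u *: v) (diag L t) = g * tlift (fun u v => e u *: v) t.
    elim/tens_ind: t => [a s t IHs IHt|a b]; first by rewrite !linearP /= IHs IHt.
    by rewrite diagE !tlift_counitl lcounit_g scalerAr.
  have Px z t : (forall h, e (z * h) = 0) ->
      tlift (fun u v => e u *: v) (skewprim L z t) = z * tlift (fun u v => e u *: v) t.
    move=> ez; elim/tens_ind: t => [a s t IHs IHt|a b]; first by rewrite !linearP /= IHs IHt.
    by rewrite skewprimE linearD /= !tlift_counitl ez lcounit_g scale0r add0r scalerAr.
  apply: (gen_ext L (tlift (fun u v => e u *: v) \o D) idfun) => [|h|h|h] /=.
  + by rewrite lcomul1 tlift_counitl lcounit1 scale1r.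
  + by rewrite lcomul_g Pg => ->.
  + by rewrite lcomul_x (Px _ _ lcounit_x) => ->.
  + by rewrite lcomul_y (Px _ _ lcounit_y) => ->.
have Pg t : tlift (fun u v => e v *: u) (diag L t) = g * tlift (fun u v => e v *: u) t.
  elim/tens_ind: t => [a s t IHs IHt|a b]; first by rewrite !linearP /= IHs IHt.
  by rewrite diagE !tlift_counitr lcounit_g scalerAr.
have Px z t : (forall h, e (z * h) = 0) ->
    tlift (fun u v => e v *: u) (skewprim L z t) = z * tlift (fun u v => e v *: u) t.
  move=> ez; elim/tens_ind: t => [a s t IHs IHt|a b]; first by rewrite !linearP /= IHs IHt.
  by rewrite skewprimE linearD /= !tlift_counitr ez scale0r addr0 scalerAr.
apply: (gen_ext L (tlift (fun u v => e v *: u) \o D) idfun) => [|h|h|h] /=.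
+ by rewrite lcomul1 tlift_counitr lcounit1 scale1r.
+ by rewrite lcomul_g Pg => ->.
+ by rewrite lcomul_x (Px _ _ lcounit_x) => ->.
+ by rewrite lcomul_y (Px _ _ lcounit_y) => ->.
Qed.

Lemma lcounit_multiplicative : counit_multiplicative (e : H -> k).
Proof.
split=> [|u v]; first exact: lcounit1.
elim/(gen_ind L): u => [a u w IHu IHw||u IHu|u IHu|u IHu].
- rewrite mulrDl -scalerAl !(linearP e) /= IHu IHw [RHS]mulrDl; congr (_ + _).
  exact: mulrA.
- by rewrite lcounit1 !mul1r.
- by rewrite -mulrA !lcounit_g.
- by rewrite -mulrA !lcounit_x mul0r.
- by rewrite -mulrA !lcounit_y mul0r.
Qed.

Lemma lcomul_multiplicative : comul_multiplicative D.
Proof.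
split=> [|u v]; first exact: lcomul1.
have Mg s t : tens_mul (diag L s) t = diag L (tens_mul s t).
  elim/tens_ind: s => [a s s' IHs IHs'|a b].
    by rewrite linearP !tens_mul_linear IHs IHs' [RHS]linearP.
  rewrite diagE !tens_mul_pure; elim/tens_ind: t => [c s t IHs IHt|c e].
    by rewrite !linearP /= IHs IHt.
  by rewrite !tens_mapE diagE /= !mulrA.
have Mx z s t : tens_mul (skewprim L z s) t = skewprim L z (tens_mul s t).
  elim/tens_ind: s => [a s s' IHs IHs'|a b].
    by rewrite linearP !tens_mul_linear IHs IHs' [RHS]linearP.
  rewrite skewprimE -[_ *t _]scale1r tens_mul_linear scale1r !tens_mul_pure.
  elim/tens_ind: t => [c s t IHs IHt|c e].
    by rewrite !linearP /= -IHs -IHt scalerDr addrACA.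
  by rewrite !tens_mapE skewprimE /= !mulrA.
elim/(gen_ind L): u => [a u w IHu IHw||u IHu|u IHu|u IHu].
- by rewrite mulrDl -scalerAl !linearP /= tens_mul_linear IHu IHw.
- rewrite mul1r lcomul1 tens_mul_pure; elim/tens_ind: (D v) => [a s t IHs IHt|a b].
    by rewrite linearP /= -IHs -IHt.
  by rewrite tens_mapE /= !mul1r.
- by rewrite -mulrA !lcomul_g Mg IHu.
- by rewrite -mulrA !lcomul_x Mx IHu.
- by rewrite -mulrA !lcomul_y Mx IHu.
Qed.

(** Both iterated coproducts turn left multiplication by a generator into the
    same operator on the triple tensor product. *)
Lemma lcomul_coassociative : coassociative D.
Proof.
pose diag3 := tens_map ( *%R g) (diag L).
pose skew3 z t := tens_map ( *%R z) idfun t + tens_map ( *%R g) (skewprim L z) t.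
have skew3_lin z : linear (skew3 z).
  exact: (linearP (tens_map ( *%R z) idfun \+ tens_map ( *%R g) (skewprim L z))).
have diag3_lin : linear diag3 by exact: linearP.
have Lg t : tens_assoc (tens_map D idfun (diag L t))
    = diag3 (tens_assoc (tens_map D idfun t)).
  elim/tens_ind: t => [a s t IHs IHt|a b]; first by rewrite !linearP /= IHs IHt diag3_lin.
  rewrite diagE !tens_mapE /= lcomul_g; elim/tens_ind: (D a) => [c s t IHs IHt|u v].
    by rewrite linearP !(tensDl, tensZl) !linearP /= IHs IHt diag3_lin.
  by rewrite diagE !tens_assocE /diag3 tens_mapE /= diagE.
have Rg t : tens_map idfun D (diag L t) = diag3 (tens_map idfun D t).
  elim/tens_ind: t => [a s t IHs IHt|a b]; first by rewrite !linearP /= IHs IHt diag3_lin.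
  by rewrite diagE /diag3 !tens_mapE /= lcomul_g.
have Lx z t : (forall h, D (z * h) = skewprim L z (D h)) ->
    tens_assoc (tens_map D idfun (skewprim L z t))
      = skew3 z (tens_assoc (tens_map D idfun t)).
  move=> Dz; elim/tens_ind: t => [a s t IHs IHt|a b].
    by rewrite !linearP /= IHs IHt skew3_lin.
  rewrite skewprimE linearD /= !tens_mapE /= Dz lcomul_g.
  elim/tens_ind: (D a) => [c s t IHs IHt|u v].
    rewrite (linearP (skewprim L z)) (linearP (diag L)) /= !(tensDl (_ *: _)) !tensZl addrACA.
    by rewrite -scalerDr !linearP /= IHs IHt skew3_lin.
  rewrite skewprimE diagE tensDl !linearD /= !tens_assocE /skew3 !tens_mapE /= skewprimE.
  by rewrite tensDr addrA.
have Rx z t : (forall h, D (z * h) = skewprim L z (D h)) ->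
    tens_map idfun D (skewprim L z t) = skew3 z (tens_map idfun D t).
  move=> Dz; elim/tens_ind: t => [a s t IHs IHt|a b].
    by rewrite !linearP /= IHs IHt skew3_lin.
  by rewrite skewprimE linearD /= !tens_mapE /skew3 !tens_mapE /= Dz.
apply: (gen_ext L ((@tens_assoc _ _ _ _ \o tens_map D idfun) \o D)
  (tens_map idfun D \o D)) => [|h|h|h] /=.
- by rewrite lcomul1 !tens_mapE /= lcomul1 tens_assocE.
- by rewrite lcomul_g Lg Rg => ->.
- by rewrite lcomul_x (Lx _ _ (lcomul_x L)) (Rx _ _ (lcomul_x L)) => ->.
- by rewrite lcomul_y (Lx _ _ (lcomul_y L)) (Rx _ _ (lcomul_y L)) => ->.
Qed.

Lemma tlift_antipodel (a b : H) : tlift (fun u v => S u * v) (a *t b) = S a * b.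
Proof.
by apply: tliftE => [w|v] c u u'; rewrite linearP ?mulrDl ?mulrDr -?scalerAl -?scalerAr.
Qed.

Lemma tlift_antipoder (a b : H) : tlift (fun u v => u * S v) (a *t b) = a * S b.
Proof.
by apply: tliftE => [w|v] c u u'; rewrite ?linearP ?mulrDl ?mulrDr -?scalerAl -?scalerAr.
Qed.

(** Applied to the coproduct of z h, the left convolution cancels termwise, while
    the right one has the form z r - g r g^-1 z, which is 0 as r is a scalar. *)
Lemma lantipodal : antipodal D e S.
Proof.
pose l t : H := tlift (fun u v => S u * v) t.
pose r t : H := tlift (fun u v => u * S v) t.
have lD : linear l by exact: linearP.
have rD : linear r by exact: linearP.
have lg t : l (diag L t) = l t.
  elim/tens_ind: t => [a s t IHs IHt|a b]; first by rewrite (linearP (diag L)) /= !lD IHs IHt.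
  by rewrite diagE /l !tlift_antipodel lantipode_g mulrA mulrVK ?gen_g_unit.
have lx z t : (forall h, S (z * h) = - (S h * (g^-1 * z))) -> l (skewprim L z t) = 0.
  move=> Sz; elim/tens_ind: t => [a s t IHs IHt|a b].
    by rewrite (linearP (skewprim L z)) lD IHs IHt scaler0 addr0.
  rewrite skewprimE /l linearD /= !tlift_antipodel Sz lantipode_g mulNr !mulrA addrC.
  by rewrite subrr.
have rg t : r (diag L t) = g * r t * g^-1.
  elim/tens_ind: t => [a s t IHs IHt|a b].
    by rewrite (linearP (diag L)) !rD IHs IHt mulrDr mulrDl -scalerAr -scalerAl.
  by rewrite diagE /r !tlift_antipoder lantipode_g !mulrA.
have rx z t : (forall h, S (z * h) = - (S h * (g^-1 * z))) ->
    r (skewprim L z t) = z * r t - g * r t * (g^-1 * z).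
  move=> Sz; elim/tens_ind: t => [a s t IHs IHt|a b].
    rewrite (linearP (skewprim L z)) !rD IHs IHt !mulrDr !mulrDl -!scalerAr -!scalerAl scalerBr.
    by rewrite opprD addrACA.
  rewrite skewprimE /r linearD /= !tlift_antipoder Sz mulrN !mulrA //.
have scal z c : g * (c *: 1) * (g^-1 * z) = c *: z.
  by rewrite -scalerAr mulr1 -scalerAl mulrA divrr ?gen_g_unit ?mul1r.
move=> h; rewrite -/(l _) -/(r _); split; elim/(gen_ind L): h => [a u v IHu IHv||h IHh|h IHh|h IHh].
- by rewrite !linearP lD IHu IHv scalerDl scalerA.
- by rewrite lcomul1 /l tlift_antipodel lantipode1 mulr1 lcounit1 scale1r.
- by rewrite lcomul_g lg lcounit_g.
- by rewrite lcomul_x (lx _ _ lantipode_x) lcounit_x scale0r.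
- by rewrite lcomul_y (lx _ _ lantipode_y) lcounit_y scale0r.
- by rewrite !linearP rD IHu IHv scalerDl scalerA.
- by rewrite lcomul1 /r tlift_antipoder lantipode1 mulr1 lcounit1 scale1r.
- by rewrite lcomul_g rg lcounit_g IHh -[g^-1]mulr1 scal.
- by rewrite lcomul_x (rx _ _ lantipode_x) lcounit_x scale0r IHh scal -scalerAr mulr1 subrr.
- by rewrite lcomul_y (rx _ _ lantipode_y) lcounit_y scale0r IHh scal -scalerAr mulr1 subrr.
Qed.

End HopfLaws.

(** * The Hopf algebras and their abstract models *)

HB.instance Definition _ (k : fieldType) (d : qdatum k) (lam : k) :=
  Vector_isCoalgebra.Build k (linked d lam)
    (lcomul_coassociative (standard_model d lam))
    (lcomul_counital (standard_model d lam)).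

HB.instance Definition _ (k : fieldType) (d : qdatum k) (lam : k) :=
  Falgebra_isHopfAlgebra.Build k (linked d lam)
    (lcomul_multiplicative (standard_model d lam))
    (lcounit_multiplicative (standard_model d lam))
    (lantipodal (standard_model d lam)).

Record linked_hopf_model (k : fieldType) (d : qdatum k) (lam : k) (H : hopfAlgType k) :=
  LinkedHopfModel {
    hopf_model :> linked_model d lam H;
    comul_gen_g : comul (gen_g hopf_model) = gen_g hopf_model *t gen_g hopf_model;
    comul_gen_x : comul (gen_x hopf_model) =
      gen_x hopf_model *t 1 + gen_g hopf_model *t gen_x hopf_model;
    comul_gen_y : comul (gen_y hopf_model) =
      gen_y hopf_model *t 1 + gen_g hopf_model *t gen_y hopf_model
  }.

Section Standard.

Variables (k : fieldType) (d : qdatum k) (lam : k).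
Local Notation L := (standard_model d lam).

Fact standard_comul_g : comul (gen_g L) = gen_g L *t gen_g L.
Proof.
rewrite -[in LHS](mulr1 (gen_g L)).
rewrite -[LHS]/(lcomul L (gen_g L * 1)).
by rewrite lcomul_g lcomul1 diagE mulr1.
Qed.

Fact standard_comul_x : comul (gen_x L) = gen_x L *t 1 + gen_g L *t gen_x L.
Proof.
rewrite -[in LHS](mulr1 (gen_x L)).
rewrite -[LHS]/(lcomul L (gen_x L * 1)).
by rewrite lcomul_x lcomul1 skewprimE !mulr1.
Qed.

Fact standard_comul_y : comul (gen_y L) = gen_y L *t 1 + gen_g L *t gen_y L.
Proof.
rewrite -[in LHS](mulr1 (gen_y L)).
rewrite -[LHS]/(lcomul L (gen_y L * 1)).
by rewrite lcomul_y lcomul1 skewprimE !mulr1.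
Qed.

Definition standard_hopf_model : linked_hopf_model d lam (linked d lam) :=
  LinkedHopfModel standard_comul_g standard_comul_x standard_comul_y.

End Standard.

(** * Contractions of the coproduct and pointedness *)

Section CoalgebraFacts.

Variables (k : fieldType) (V W : vectType k).

Lemma tens_space_pure (U : {vspace V}) (U' : {vspace W}) u u' :
  u \in U -> u' \in U' -> u *t u' \in tens_space U U'.
Proof.
move=> /coord_vbasis-> /coord_vbasis->.
elim/big_rec: _ => [|i t _ IHt]; first by rewrite tens0l mem0v.
rewrite tensDl tensZl memvD ?memvZ //.
elim/big_rec: _ => [|j w _ IHw]; first by rewrite tens0r mem0v.
rewrite tensDr tensZr memvD ?memvZ // memv_span //.
by apply/allpairsP; exists ((vbasis U)`_i, (vbasis U')`_j); rewrite !mem_nth ?size_tuple.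
Qed.

Lemma contract_mem (F : {linear W -> k^o}) (U : {vspace V}) (U' : {vspace W})
    (t : tensor V W) :
  t \in tens_space U U' -> tlift (fun v w => (F w : k) *: v) t \in U.
Proof.
pose f := linfun (tlift (fun (v : V) (w : W) => (F w : k) *: v)).
suff: (tens_space U U' <= f @^-1: U)%VS.
  by move/subvP=> sub /sub; rewrite -memv_preim lfunE.
apply/span_subvP=> _ /allpairsP[[v w] /= [Uv _ ->]].
rewrite -memv_preim lfunE /= tliftE; first by rewrite memvZ // vbasis_mem.
  by move=> w' a u u'; rewrite scalerDr !scalerA mulrC.
by move=> v' a u u'; rewrite linearP /= scalerDl scalerA.
Qed.

End CoalgebraFacts.

Section LinkedHopfTheory.

Variables (k : fieldType) (d : qdatum k) (lam : k) (H : hopfAlgType k).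
Variable (L : linked_hopf_model d lam H).
Local Notation p := (qord d).
Local Notation q := (qroot d).
Local Notation g := (gen_g L).
Local Notation x := (gen_x L).
Local Notation y := (gen_y L).

Lemma comul_g h : comul (g * h) = diag L (comul h).
Proof.
by rewrite (proj2 comulM) comul_gen_g tens_mul_pure.
Qed.

Lemma comul_gX n : comul (g ^+ n) = g ^+ n *t g ^+ n.
Proof.
elim: n => [|n IHn]; first by rewrite (proj1 comulM).
by rewrite exprS comul_g IHn diagE.
Qed.

Fact comul_skew z : comul z = z *t 1 + g *t z -> forall h,
  comul (z * h) = skewprim L z (comul h).
Proof.
move=> Dz h; rewrite (proj2 comulM) Dz -[z *t 1]scale1r tens_mul_linear scale1r.
rewrite !tens_mul_pure /skewprim; congr (_ + _).
elim/tens_ind: (comul h) => [c s t IHs IHt|a b]; first by rewrite !linearP /= IHs IHt.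
by rewrite tens_mapE /= skewlE mul1r.
Qed.

Definition comul_x := comul_skew (comul_gen_x L).
Definition comul_y := comul_skew (comul_gen_y L).

Lemma skewprim_iter z c n u v : g * z = c *: (z * g) ->
  iter n (skewprim L z) (u *t v) =
  \sum_(i < n.+1) qbin c n i *: ((z ^+ (n - i) * (g ^+ i * u)) *t (z ^+ i * v)).
Proof.
move=> gz; rewrite (qbinomial (skewrl gz)); apply: eq_bigr => i _.
by rewrite skewr_iter skewl_iter.
Qed.

Lemma comul_xX n h : comul (x ^+ n * h) = iter n (skewprim L x) (comul h).
Proof. by elim: n => [|n IHn]; rewrite ?mul1r // exprS -mulrA comul_x IHn. Qed.

Lemma comul_yX n h : comul (y ^+ n * h) = iter n (skewprim L y) (comul h).
Proof. by elim: n => [|n IHn]; rewrite ?mul1r // exprS -mulrA comul_y IHn. Qed.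

(** The quantum binomial formula applied to the powers of x and then of y; the
    second tensor factors come out as basis monomials. *)
Lemma comul_mono b c a :
  comul (x ^+ b * (y ^+ c * g ^+ a)) =
  \sum_(j < c.+1) \sum_(i < b.+1) (qbin q^-1 c j * qbin q b i) *:
    ((x ^+ (b - i) * (g ^+ i * (y ^+ (c - j) * (g ^+ j * g ^+ a))))
      *t (x ^+ i * (y ^+ j * g ^+ a))).
Proof.
rewrite comul_xX comul_yX comul_gX (skewprim_iter _ _ _ (gen_gy L)).
rewrite linear_sum; apply: eq_bigr => j _; rewrite linearZ /=.
rewrite (skewprim_iter _ _ _ (gen_gx L)) scaler_sumr.
by apply: eq_bigr => i _; rewrite scalerA.
Qed.

(** Contraction of the second factor with the coefficient functional of the
    monomial with index i. *)
Definition slice (i : 'I_p * 'I_p * 'I_(p ^ 2)) (t : tensor H H) : H :=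
  tlift (fun u v => (coords L v i : k) *: u) t.

HB.instance Definition _ i :=
  GRing.isLinear.Build k (tensor H H) H _ (slice i) (tliftP _).

Lemma sliceE i u v : slice i (u *t v) = (coords L v i : k) *: u.
Proof.
apply: tliftE => [w|w] a s t; first by rewrite scalerDr !scalerA mulrC.
by rewrite linearP !ffunE scalerDl scalerA.
Qed.

Lemma slice_mem i (D E : {vspace H}) t : t \in tens_space D E -> slice i t \in D.
Proof.
pose F (h : H) : k^o := coords L h i.
have linF : linear F by move=> a u v; rewrite /F linearP !ffunE.
pose f : {linear H -> k^o} := HB.pack F (GRing.isLinear.Build _ _ _ _ F linF).
exact: (@contract_mem _ _ _ f).
Qed.

Lemma gen_gy_pow n m : g ^+ n * y ^+ m = q^-1 ^+ (n * m) *: (y ^+ m * g ^+ n).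
Proof.
have gyn a : g ^+ a * y = q^-1 ^+ a *: (y * g ^+ a).
  elim: a => [|a IHa]; first by rewrite mul1r mulr1 scale1r.
  by rewrite exprSr -mulrA gen_gy -scalerAr !mulrA IHa -scalerAl scalerA -exprS.
elim: m => [|m IHm]; first by rewrite muln0 mul1r mulr1 scale1r.
rewrite exprSr mulrA IHm -scalerAl -[_ * _ * y]mulrA gyn -scalerAr scalerA -exprD.
by rewrite mulnS addnC mulrA.
Qed.

Lemma slice_comul_mono (i0 j0 : 'I_p) (l : 'I_(p ^ 2)) (b c a : nat) :
    (b < p)%N -> (c < p)%N -> (a < p ^ 2)%N ->
  coords L (slice (i0, j0, l) (comul (x ^+ b * (y ^+ c * g ^+ a)))) =
  (if a == l then qbin q^-1 c j0 * qbin q b i0 * q^-1 ^+ (i0 * (c - j0)) else 0)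
    *: lmono (b - i0) (c - j0) (l + i0 + j0).
Proof.
move=> lt_b lt_c lt_a; rewrite comul_mono (linear_sum (slice _)) (linear_sum (coords L)) /=.
have ltp m m' : (m < p)%N -> (m - m' < p)%N by apply: leq_ltn_trans (leq_subr _ _).
have termE (i j : nat) : (i < b.+1)%N -> (j < c.+1)%N ->
    slice (i0, j0, l) ((x ^+ (b - i) * (g ^+ i * (y ^+ (c - j) * (g ^+ j * g ^+ a))))
      *t (x ^+ i * (y ^+ j * g ^+ a)))
    = ((i0 == i :> nat) && (j0 == j :> nat) && (l == a :> nat))%:R *:
      (x ^+ (b - i) * (g ^+ i * (y ^+ (c - j) * (g ^+ j * g ^+ a)))).
  rewrite !ltnS => le_i le_j.
  rewrite sliceE mulrA coords_mono ?(leq_ltn_trans le_i lt_b) ?(leq_ltn_trans le_j lt_c) //.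
  by rewrite ffunE /= (modn_small lt_a).
(* The chosen monomial is then absent from the expansion, while on the right-hand
   side the test on a fails or a binomial coefficient vanishes. *)
have zero_case : [|| b < i0, c < j0 | a != l]%N ->
    forall (i : 'I_b.+1) (j : 'I_c.+1), [&& i0 == i :> nat, j0 == j :> nat & l == a :> nat] = false.
  move=> small i j; apply: contraTF small => /and3P[/eqP-> /eqP-> /eqP->].
  by rewrite eqxx orbF negb_or -!leqNgt; apply/andP; split; rewrite -ltnS.
have [small|] := boolP [|| b < i0, c < j0 | a != l]%N.
  rewrite big1 => [|j _]; last first.
    rewrite (linear_sum (slice _)) (linear_sum (coords L)) big1 //= => i _.
    rewrite (linearZ_LR (slice _)) /= termE // -andbA zero_case //.
    by rewrite scale0r scaler0 linear0.
  case/or3P: small => [lt_b_i|lt_c_j|/negPf->]; last by rewrite scale0r.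
  - by rewrite [qbin q b _]qbin_small // mulr0 mul0r if_same scale0r.
  - by rewrite [qbin _ c _]qbin_small // !mul0r if_same scale0r.
rewrite !negb_or -!leqNgt negbK => /and3P[le_i le_j /eqP a_l].
subst a; rewrite eqxx.
rewrite (bigD1 (Ordinal (le_j : (j0 < c.+1)%N))) //= [X in _ + X]big1 ?addr0; last first.
  move=> j ne_j; rewrite (linear_sum (slice _)) (linear_sum (coords L)) big1 //= => i _.
  rewrite (linearZ_LR (slice _)) /= termE //.
  rewrite -val_eqE /= eq_sym in ne_j.
  by rewrite (negPf ne_j) andbF scale0r scaler0 linear0.
rewrite (linear_sum (slice _)) (linear_sum (coords L)) /=.
rewrite (bigD1 (Ordinal (le_i : (i0 < b.+1)%N))) //= [X in _ + X]big1 ?addr0; last first.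
  move=> i ne_i; rewrite (linearZ_LR (slice _)) /= termE //.
  rewrite -val_eqE /= eq_sym in ne_i.
  by rewrite (negPf ne_i) scale0r scaler0 linear0.
rewrite (linearZ_LR (slice _)) (linearZ_LR (coords L)) /= termE // !eqxx scale1r.
have -> : x ^+ (b - i0) * (g ^+ i0 * (y ^+ (c - j0) * (g ^+ j0 * g ^+ l)))
    = q^-1 ^+ (i0 * (c - j0)) *: (x ^+ (b - i0) * y ^+ (c - j0) * g ^+ (l + i0 + j0)).
  rewrite -!exprD [g ^+ i0 * _]mulrA gen_gy_pow -scalerAl -scalerAr; congr (_ *: _).
  rewrite -[RHS]mulrA -[_ * _ * g ^+ (j0 + l)]mulrA -exprD.
  by congr (_ * (_ * _ ^+ _)); rewrite addnC -addnA addnC.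
by rewrite (linearZ_LR (coords L)) /= coords_mono ?ltp // scalerA.
Qed.

Lemma coords_gpow n : coords L (g ^+ n) = lmono 0 0 n.
Proof. by rewrite -(coords_mono L n (qord_gt0 d) (qord_gt0 d)) !mul1r. Qed.

(** Only the monomials of h with the exponent l of g contribute, and at most one
    term of each: the one whose second factor is the chosen monomial. *)
Lemma slice_comul (i0 j0 : 'I_p) (l : 'I_(p ^ 2)) h :
  coords L (slice (i0, j0, l) (comul h)) =
  \sum_(i : 'I_p * 'I_p * 'I_(p ^ 2) | i.2 == l)
     ((coords L h i : k)
      * (qbin q^-1 i.1.2 j0 * qbin q i.1.1 i0 * q^-1 ^+ (i0 * (i.1.2 - j0))))
     *: lmono (i.1.1 - i0) (i.1.2 - j0) (l + i0 + j0).
Proof.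
rewrite [in LHS](coords_sum L h) (linear_sum comul) (linear_sum (slice _)).
rewrite (linear_sum (coords L)) /= [RHS]big_mkcond /=.
apply: eq_bigr => -[[b c] a] _ /=.
rewrite -mulrA (linearZ_LR comul) (linearZ_LR (slice _)) (linearZ_LR (coords L)) /= slice_comul_mono //.
by rewrite -val_eqE /=; case: eqP => _; rewrite scalerA // mulr0 scale0r.
Qed.

(** Subtracting i0 and j0 from the exponents identifies different monomials only
    when the truncated subtraction is not exact, where a coefficient vanishes. *)
Lemma slice_coef (i0 j0 b c b' c' : 'I_p) (l a : 'I_(p ^ 2)) h :
    b = (b' + i0)%N :> nat -> c = (c' + j0)%N :> nat ->
  coords L (slice (i0, j0, l) (comul h)) (b', c', a) =
  if a == ((l + i0 + j0) %% p ^ 2)%N :> nat then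
    (coords L h (b, c, l) : k)
    * (qbin q^-1 c j0 * qbin q b i0 * q^-1 ^+ (i0 * c'))
  else 0.
Proof.
move=> bE cE; rewrite slice_comul sum_ffunE (bigD1 (b, c, l)) //= [X in _ + X]big1.
  rewrite addr0 !ffunE /= bE cE !addnK !eqxx /=; case: eqP => _ /=; last exact: scaler0.
  by rewrite /GRing.scale /= mulr1.
case=> [[b1 c1] a1] /= /andP[/eqP-> ne]; rewrite !ffunE /=.
have [lt_b|le_b] := ltnP b1 i0; first by rewrite [qbin q b1 _]qbin_small // mulr0 mul0r mulr0 scale0r.
have [lt_c|le_c] := ltnP c1 j0; first by rewrite [qbin _ c1 _]qbin_small // !mul0r mulr0 scale0r.
case: eqP => [b1E|_] /=; last by rewrite scaler0.
case: eqP => [c1E|_] /=; last by rewrite scaler0.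
case/negP: ne; apply/eqP; congr (_, _, _); apply/val_inj => /=.
  by rewrite bE b1E subnK.
by rewrite cE c1E subnK.
Qed.

(** Take an index (i0, j0, l) in the support of h with i0 + j0 maximal.  A term
    that survives the contraction has exponents at least i0 and j0, so it comes
    from the chosen monomial itself and both differences are 0. *)
Lemma top_slice h : h != 0 ->
  exists i s, coords L h i != 0 /\ slice i (comul h) = (coords L h i : k) *: g ^+ s.
Proof.
move=> h_neq0; have [i1 hi1] : exists i, coords L h i != 0.
  apply/existsP; apply: contraNT h_neq0 => /existsPn /= h0.
  rewrite -(inj_eq (@coords_inj _ _ _ _ L)) linear0; apply/eqP/ffunP=> i.
  by rewrite ffunE; apply/eqP; rewrite -[_ == _]negbK h0.
pose P i := coords L h i != 0.
have [i Pi max_i] := @arg_maxnP _ i1 P (fun i => i.1.1 + i.1.2)%N hi1.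
case: i Pi max_i => [[i0 j0] l] hi max_i.
exists (i0, j0, l), (l + i0 + j0)%N; split=> //.
apply: (@coords_inj _ _ _ _ L); rewrite slice_comul (bigD1 (i0, j0, l)) //=.
rewrite [X in _ + X]big1 ?addr0 => [|[[b c] a]] /=.
  rewrite !qbinn !subnn muln0 !mulr1 linearZ /=; congr (_ *: _).
  by rewrite coords_gpow.
case/andP=> /eqP-> ne.
have [lt_b|le_b] := ltnP b i0; first by rewrite [qbin q b _]qbin_small // mulr0 mul0r mulr0 scale0r.
have [lt_c|le_c] := ltnP c j0; first by rewrite [qbin _ c _]qbin_small // !mul0r mulr0 scale0r.
have [->|hbc] := eqVneq (coords L h (b, c, l)) 0; first by rewrite mul0r scale0r.
case/negP: ne; have /= max_bc := max_i _ hbc.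
have b_i : b = i0.
  apply/val_inj/eqP; rewrite eqn_leq le_b andbT -(leq_add2r c).
  by rewrite (leq_trans max_bc) // leq_add2l.
rewrite b_i /= leq_add2l in max_bc.
by apply/eqP; congr (_, _, _) => //; apply/val_inj/eqP; rewrite eqn_leq max_bc.
Qed.

(** A simple subcoalgebra contains a power of g, which spans a subcoalgebra. *)
Lemma model_pointed : pointed H.
Proof.
move=> D [subD D0 simpleD].
have [|i [s [hi sliceD]]] := @top_slice (vpick D); first by rewrite vpick0; apply/eqP.
have gD : g ^+ s \in D.
  have := slice_mem i (subD _ (memv_pick D)).
  rewrite sliceD => hgD; rewrite -[g ^+ s]scale1r -(mulVf hi) -scalerA.
  exact: memvZ.
have gs_neq0 : g ^+ s != 0.
  by apply: contraTneq (unitrX s (gen_g_unit L)) => ->; rewrite unitr0.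
have sub_g : subcoalgebra <[g ^+ s]>%VS.
  move=> _ /vlineP[c ->]; rewrite linearZ /= comul_gX memvZ //.
  by rewrite tens_space_pure ?memv_line.
case: (simpleD _ sub_g) => [|/eqP|<-]; first by rewrite -memvE.
  by rewrite -dimv_eq0 dim_vline gs_neq0.
by rewrite dim_vline gs_neq0.
Qed.

(** Here the contraction of [top_slice] is also a multiple of u. *)
Lemma grouplike_pow u : u != 0 -> comul u = u *t u -> exists s, u = g ^+ s.
Proof.
move=> u0 Du; have [i [s [ui]]] := top_slice u0.
rewrite Du sliceE => us; exists s.
by rewrite -[u]scale1r -(mulVf ui) -scalerA us scalerA mulVf // scale1r.
Qed.

Lemma gen_gx_pow n m : g ^+ n * x ^+ m = q ^+ (n * m) *: (x ^+ m * g ^+ n).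
Proof.
have gxn a : g ^+ a * x = q ^+ a *: (x * g ^+ a).
  elim: a => [|a IHa]; first by rewrite mul1r mulr1 scale1r.
  by rewrite exprSr -mulrA gen_gx -scalerAr !mulrA IHa -scalerAl scalerA -exprS.
elim: m => [|m IHm]; first by rewrite muln0 mul1r mulr1 scale1r.
rewrite exprSr mulrA IHm -scalerAl -[_ * _ * x]mulrA gxn -scalerAr scalerA -exprD.
by rewrite mulnS addnC mulrA.
Qed.

(** Conjugation by g^s is diagonal in the basis of monomials. *)
Lemma coords_eigen s c h : g ^+ s * h = c *: (h * g ^+ s) ->
  forall i, coords L h i = 0 \/ q ^+ (s * i.1.1) * q^-1 ^+ (s * i.1.2) = c.
Proof.
move=> gh i; pose w (i : 'I_p * 'I_p * 'I_(p ^ 2)) := q ^+ (s * i.1.1) * q^-1 ^+ (s * i.1.2).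
pose v : linked d lam := [ffun i => w i * (coords L h i : k)].
have: v = c *: coords L h.
  rewrite -linearZ -[c *: h](mulrK (unitrX s (gen_g_unit L))) -scalerAl -gh.
  rewrite [h in RHS](coords_sum L h) mulr_sumr mulr_suml linear_sum [LHS]lmono_sum.
  apply: eq_bigr => -[[b c'] a] _ /=; rewrite ffunE -scalerAr -scalerAl linearZ /=.
  suff -> : g ^+ s * (x ^+ b * y ^+ c' * g ^+ a) / g ^+ s
      = w (b, c', a) *: (x ^+ b * y ^+ c' * g ^+ a).
    by rewrite linearZ /= coords_mono // scalerA mulrC.
  rewrite !mulrA gen_gx_pow -!scalerAl -[_ * g ^+ s * y ^+ _]mulrA gen_gy_pow.
  rewrite -!scalerAr -!scalerAl scalerA mulrA -[_ * g ^+ s * g ^+ a]mulrA -exprD.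
  by rewrite addnC exprD mulrA mulrK // unitrX // gen_g_unit.
move/ffunP/(_ i); rewrite !ffunE => /eqP.
rewrite -subr_eq0 -mulrBl mulf_eq0 subr_eq0 => /orP[/eqP wc|/eqP h0]; last by left.
by right.
Qed.

Let o : 'I_p := Ordinal (qord_gt0 d).
Let i1 : 'I_p := Ordinal (qord_gt1 d).
Let o2 : 'I_(p ^ 2) := Ordinal (sqr_qord_gt0 d).

(** Contract with 1, x and y, up to a power g^l, and compare coefficients with
    those of z *t 1 + g^s *t z.  The contraction with g^l forces l = 0 outside the
    span of the powers of g; the other two lower the degree by one, with a nonzero
    factor [b]_q or [c]_(1/q), and must give a multiple of g^s. *)
Lemma skewprim_support s z i : comul z = z *t 1 + g ^+ s *t z -> coords L z i != 0 ->
  (i.1 = (o, o)) \/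
  [/\ i.2 = o2, s = 1 %[mod p ^ 2] & i.1 = (i1, o) \/ i.1 = (o, i1)].
Proof.
move=> Dz zi.
have sliceZ j : coords L (slice j (comul z))
    = (lmono 0 0 0 : linked d lam) j *: coords L z + (coords L z j : k) *: (lmono 0 0 s : linked d lam).
  rewrite Dz (linearD (slice _)) /= !sliceE coords1 (linearD (coords L)).
  by rewrite !(linearZ_LR (coords L)) /= coords_gpow.
have p2_gt1 : (1 < p ^ 2)%N by rewrite (leq_trans (qord_gt1 d)) // leq_pmull // qord_gt0.
case: i zi => [[b c] l] /= zi.
have [/eqP bc0|bc] := boolP ((b, c) == (o, o)); first by left.
right; have bc_nz : (b == 0%N :> nat) && (c == 0%N :> nat) = false.
  by apply: contraNF bc => /andP[/eqP b0 /eqP c0]; apply/eqP; congr (_, _); apply/val_inj.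
have l0 : l = o2.
  apply/val_inj/eqP; apply: contraTT zi => /negPf l_nz; rewrite negbK.
  have := @slice_coef o o b c b c l l z (esym (addn0 _)) (esym (addn0 _)).
  rewrite sliceZ !ffunE /= !addn0 mod0n (modn_small (ltn_ord l)) eqxx bc_nz.
  rewrite (l_nz : (l == 0%N :> nat) = false) !qbin0 mul0n !mulr1 scale0r.
  by rewrite [_ *: 0]scaler0 addr0 => <-.
(* Contraction with x or y, according to the index (1, 0) or (0, 1). *)
have step (i0 j0 : 'I_p) : (i0 <= b)%N -> (j0 <= c)%N -> (i0 + j0 = 1)%N ->
    qbin q^-1 c j0 * qbin q b i0 != 0 ->
  [/\ b = i0, c = j0 & s = 1 %[mod p ^ 2]].
  move=> le_i le_j ij1 qnz.
  have lt_b : (b - i0 < p)%N by rewrite (leq_ltn_trans (leq_subr _ _)).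
  have lt_c : (c - j0 < p)%N by rewrite (leq_ltn_trans (leq_subr _ _)).
  have := @slice_coef i0 j0 b c (Ordinal lt_b) (Ordinal lt_c) l (Ordinal p2_gt1) z
    (esym (subnK le_i)) (esym (subnK le_j)).
  rewrite sliceZ !ffunE /= l0 /= add0n ij1 mod0n.
  rewrite (modn_small p2_gt1) !eqxx.
  have -> : (i0 == 0%N :> nat) && (j0 == 0%N :> nat) = false.
    by apply/negP=> /andP[/eqP i00 /eqP j00]; rewrite i00 j00 in ij1.
  rewrite scale0r add0r => zE; subst l.
  have : coords L z (b, c, o2)
      * (qbin q^-1 c j0 * qbin q b i0 * q^-1 ^+ (i0 * (c - j0))) != 0 :> k.
    apply: mulf_neq0 => //; apply: mulf_neq0 => //.
    by rewrite expf_neq0 // invr_eq0 qroot_neq0.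
  rewrite -zE; have [/andP[/andP[/eqP bi /eqP cj] /eqP s1] _|_] := boolP (_ && _); last first.
    by rewrite [_ *: _]mulr0 eqxx.
  split; last by rewrite -s1.
    by apply/val_inj/eqP; rewrite eqn_leq le_i andbT -subn_eq0 bi.
  by apply/val_inj/eqP; rewrite eqn_leq le_j andbT -subn_eq0 cj.
have [b0|b_gt0] := posnP b.
  have c_gt0 : (0 < c)%N by move: bc_nz; rewrite b0 lt0n /= => ->.
  have [||||-> -> s1] := step o i1 => //.
    by rewrite qbin1 qbin0 mulr1 (qint_eq0 (qrootV_prim d)) ?qord_gt1 // gtnNdvd.
  by split=> //; right.
have [||||-> -> s1] := step i1 o => //.
  by rewrite qbin1 qbin0 mul1r (qint_eq0 (qroot_prim d)) ?qord_gt1 // gtnNdvd.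
by split=> //; left.
Qed.

(** The eigenvalue c <> 1 excludes powers of g, which leaves x and y by
    [skewprim_support]; that lemma also gives s = 1 modulo p^2 as soon as z <> 0. *)
Lemma skewprim_eigen s z c : z != 0 -> c != 1 ->
    comul z = z *t 1 + g ^+ s *t z -> g ^+ s * z = c *: (z * g ^+ s) ->
  g ^+ s = g /\ exists a b, [/\ z = a *: x + b *: y,
    q != c -> a = 0 & q^-1 != c -> b = 0].
Proof.
move=> z0 c1 Dz gz; have eig := coords_eigen gz.
have zoo l : coords L z (o, o, l) = 0.
  case: (eig (o, o, l)) => //= cE; case/eqP: c1.
  by rewrite -cE !muln0 mulr1.
(* Some coefficient is nonzero, and its index has to be that of x or y. *)
have [i zi] : exists i, coords L z i != 0.
  apply/existsP; apply: contraNT z0 => /existsPn /= h0.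
  rewrite -(inj_eq (@coords_inj _ _ _ _ L)) linear0; apply/eqP/ffunP=> i.
  by rewrite ffunE; apply/eqP; rewrite -[_ == _]negbK h0.
have gs : g ^+ s = g.
  have [i00|[_ s1 _]] := skewprim_support Dz zi.
    by case: i zi i00 => [bc l] /= + bc0; rewrite bc0 zoo eqxx.
  apply: (@coords_inj _ _ _ _ L).
  by rewrite -[g in RHS]expr1 !coords_gpow -lmono_mod s1 lmono_mod.
rewrite gs in gz *; split=> //.
have eig1 : forall i, coords L z i = 0 \/ q ^+ i.1.1 * q^-1 ^+ i.1.2 = c.
  move=> j; rewrite -(expr1 g) in gz; have := coords_eigen gz j.
  by rewrite !mul1n.
exists (coords L z (i1, o, o2)), (coords L z (o, i1, o2)); split.
- apply: (@coords_inj _ _ _ _ L); rewrite linearD !linearZ /= [LHS]lmono_sum.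
  rewrite (bigD1 (i1, o, o2)) //= (bigD1 (o, i1, o2)) //= addrA big1 ?addr0.
    congr (_ *: _ + _ *: _).
      by rewrite -(@coords_mono _ _ _ _ L 1 0 0) ?qord_gt1 ?qord_gt0 // !mulr1.
    by rewrite -(@coords_mono _ _ _ _ L 0 1 0) ?qord_gt1 ?qord_gt0 // mulr1 mul1r.
  move=> [bc l] /andP[ne1 ne2]; have [->|nz] := eqVneq (coords L z (bc, l)) 0.
    by rewrite scale0r.
  have [/= bc0|[/= l0 _ [/= bcE|/= bcE]]] := skewprim_support Dz nz.
  + by rewrite bc0 zoo eqxx in nz.
  + by rewrite bcE l0 eqxx in ne1.
  + by rewrite bcE l0 eqxx in ne2.
- by move=> /eqP qc; case: (eig1 (i1, o, o2)) => //=; rewrite mulr1 expr1.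
- by move=> /eqP qc; case: (eig1 (o, i1, o2)) => //=; rewrite mul1r expr1.
Qed.

Lemma gen_gX_inj n m : (n < p ^ 2)%N -> (m < p ^ 2)%N -> g ^+ n = g ^+ m -> n = m.
Proof.
move=> lt_n lt_m /(congr1 (coords L)); rewrite !coords_gpow.
move/ffunP/(_ (o, o, Ordinal lt_n)); rewrite !ffunE /= !modn_small // eqxx /=.
by case: eqP => // _ /eqP; rewrite oner_eq0.
Qed.

Lemma gen_x_neq0 : x != 0.
Proof.
apply/eqP=> x0; have := coords_mono L 0 (qord_gt1 d) (qord_gt0 d).
rewrite expr1 x0 !mul0r linear0 => /ffunP/(_ (i1, o, o2)); rewrite !ffunE /= mod0n.
by move/eqP; rewrite eq_sym oner_eq0.
Qed.

Lemma gen_y_neq0 : y != 0.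
Proof.
apply/eqP=> y0; have := coords_mono L 0 (qord_gt0 d) (qord_gt1 d).
rewrite expr1 y0 mulr0 mul0r linear0 => /ffunP/(_ (o, i1, o2)); rewrite !ffunE /= mod0n.
by move/eqP; rewrite eq_sym oner_eq0.
Qed.

End LinkedHopfTheory.

(** * Isomorphisms preserve the p-th power of the linking scalar *)

Section Isomorphism.

Variables (k : fieldType) (d : qdatum k) (lam mu : k) (H K : hopfAlgType k).
Variables (L : linked_hopf_model d lam H) (L' : linked_hopf_model d mu K).
Local Notation p := (qord d).
Local Notation q := (qroot d).

Lemma qord_gt2 : (2 < p)%N.
Proof.
by rewrite ltn_neqAle qord_gt1 andbT; apply: contraTneq (qord_odd d) => <-.
Qed.

Lemma qexp_neq1 n : (0 < n < p)%N -> q ^+ n != 1.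
Proof.
case/andP=> n_gt0 lt_n; rewrite -(prim_order_dvd (qroot_prim d)).
by rewrite gtnNdvd.
Qed.

Lemma qroot_neq1 : q != 1.
Proof. by rewrite -[q]expr1 qexp_neq1 ?qord_gt1. Qed.

Lemma qrootV_neq : q^-1 != q.
Proof.
apply: contraTneq (qexp_neq1 (n := 2) qord_gt2) => qV.
by rewrite expr2 -{1}qV mulVf ?qroot_neq0 // eqxx.
Qed.

(** An isomorphism multiplies x and y by scalars; these are p-th roots of unity
    since x^p = y^p = g^p - 1 is fixed, and their product turns mu into lam. *)
Lemma hopf_isomorphic_link : hopf_isomorphic H K -> lam ^+ p = mu ^+ p.
Proof.
case=> f [bij_f comul_f _ _]; have f_inj := bij_inj bij_f.
have f0 h : h != 0 -> f h != 0 by rewrite -(inj_eq f_inj) raddf0.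
have [||s fg] := @grouplike_pow _ _ _ _ L' (f (gen_g L)).
- by apply: f0; apply: contraTneq (gen_g_unit L) => ->; rewrite unitr0.
- by rewrite comul_f comul_gen_g tens_mapE.
have f_skew z : comul z = z *t 1 + gen_g L *t z ->
    comul (f z) = f z *t 1 + gen_g L' ^+ s *t f z.
  by move=> Dz; rewrite comul_f Dz linearD /= !tens_mapE /= rmorph1 fg.
have f_eig z c : gen_g L * z = c *: (z * gen_g L) ->
    gen_g L' ^+ s * f z = c *: (f z * gen_g L' ^+ s).
  by move=> /(congr1 f); rewrite (linearZ_LR f) /= !rmorphM /= fg.
have [gs [a [b [fx _ b0]]]] := skewprim_eigen (f0 _ (gen_x_neq0 L)) qroot_neq1
  (f_skew _ (comul_gen_x L)) (f_eig _ _ (gen_gx L)).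
have qV_neq1 : q^-1 != 1 by rewrite invr_eq1 qroot_neq1.
have [_ [a' [b' [fy a'0 _]]]] := skewprim_eigen (f0 _ (gen_y_neq0 L)) qV_neq1
  (f_skew _ (comul_gen_y L)) (f_eig _ _ (gen_gy L)).
rewrite (b0 qrootV_neq) scale0r addr0 in fx.
rewrite (a'0 _) 1?eq_sym ?qrootV_neq // scale0r add0r in fy.
rewrite gs in fg.
(* The powers of g that enter the relations are not 1, as 2 and p lie strictly
   between 0 and p^2. *)
have gp_neq1 n : (0 < n < p ^ 2)%N -> 1 - gen_g L' ^+ n != 0.
  case/andP=> n_gt0 lt_n; rewrite subr_eq0 -(expr0 (gen_g L')).
  apply: contraTneq n_gt0 => /(gen_gX_inj (sqr_qord_gt0 d) lt_n) <-.
  by rewrite ltnn.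
have lt_p : (0 < p < p ^ 2)%N by rewrite qord_gt0 -[X in (X < _)%N]expn1 ltn_exp2l ?qord_gt1.
have pow1 z c : f z = c *: gen_x L' \/ f z = c *: gen_y L' ->
    z ^+ p = gen_g L ^+ p - 1 -> c ^+ p = 1.
  move=> fz /(congr1 f); rewrite rmorphB !rmorphXn rmorph1 /= fg => zp.
  have : (1 - c ^+ p) *: (1 - gen_g L' ^+ p) = 0.
    apply/eqP; rewrite scalerBl scale1r subr_eq0 -[X in X == _]opprB -zp.
    by case: fz => ->; rewrite exprZn (gen_x_pow, gen_y_pow) -scalerN opprB.
  by move/eqP; rewrite scaler_eq0 (negPf (gp_neq1 _ lt_p)) orbF subr_eq0 eq_sym => /eqP.
have ap := pow1 _ _ (or_introl fx) (gen_x_pow L).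
have bp := pow1 _ _ (or_intror fy) (gen_y_pow L).
have : (q * (lam - b' * a * mu)) *: (1 - gen_g L' ^+ 2) = 0.
  have := congr1 f (gen_yx L); rewrite rmorphM rmorphD /= !(linearZ_LR f) /=.
  rewrite rmorphB rmorphM rmorphXn rmorph1 /= fg fx fy.
  rewrite -!scalerAl -!scalerAr gen_yx.
  move: (1 - gen_g L' ^+ 2) => w.
  rewrite !scalerDr !scalerA (_ : b' * a * q = q * a * b'); last by ring.
  move/addrI => eq_mu; apply/eqP; rewrite mulrBr scalerBl -eq_mu subr_eq0.
  by apply/eqP; congr (_ *: _); ring.
have lt_2 : (0 < 2 < p ^ 2)%N by rewrite /= (leq_trans qord_gt2) // leq_pmulr // qord_gt0.
move/eqP; rewrite scaler_eq0 (negPf (gp_neq1 _ lt_2)) orbF mulf_eq0.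
rewrite (negPf (qroot_neq0 d)) /= subr_eq0 => /eqP->.
by rewrite !exprMn ap bp !mul1r.
Qed.

End Isomorphism.

Lemma dim_linked (k : fieldType) (d : qdatum k) (lam : k) :
  \dim (@fullv k (linked d lam)) = (qord d ^ 4)%N.
Proof.
rewrite dimvf -[LHS]/(#|{: 'I_(qord d) * 'I_(qord d) * 'I_(qord d ^ 2)}| * 1)%N.
by rewrite muln1 !card_prod !card_ord mulnn -expnD.
Qed.

(** A root of 1 + z + ... + z^(p - 1) has order dividing p, and it is not 1 since
    p <> 0 in k. *)
Lemma prim_root_exists (k : closedFieldType) (p : nat) :
  ([pchar k] =i pred0)%R -> prime p -> exists z : k, p.-primitive_root z.
Proof.
move=> k_char0 p_prime; have p_gt1 := prime_gt1 p_prime.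
have [z zE] := @solve_monicpoly k p.-1 (fun _ => -1) (ltac:(by rewrite -subn1 subn_gt0)).
have sum0 : \sum_(i < p) z ^+ i = 0.
  rewrite -(prednK (prime_gt0 p_prime)) big_ord_recr /= zE -big_split big1 //= => i _.
  by rewrite mulN1r subrr.
have zp : z ^+ p = 1 by apply/eqP; rewrite -subr_eq0 subrX1 sum0 mulr0.
have [m m_prim m_dvd] := prim_order_exists (prime_gt0 p_prime) zp.
exists z; suff <- : m = p by [].
apply/(prime_nt_dvdP p_prime) => //; apply/eqP=> m1.
have z1 : z = 1 by rewrite -[z]expr1 -m1 prim_expr_order.
have := sum0; rewrite (eq_bigr (fun=> 1)) => [|i _]; last by rewrite z1 expr1n.
rewrite sumr_const card_ord => /eqP; rewrite (proj1 (pcharf0P k) k_char0).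
by rewrite -leqn0 leqNgt prime_gt0.
Qed.

Lemma natr_exp_inj (k : fieldType) (n a b : nat) :
  ([pchar k] =i pred0)%R -> (0 < n)%N -> (a%:R ^+ n = b%:R ^+ n :> k) -> a = b.
Proof.
move=> k_char0 n_gt0; wlog le_ab : a b / (a <= b)%N => [thm ab|].
  by case/orP: (leq_total a b) => le; [apply: thm | apply/esym/thm].
rewrite -!natrX => /esym/eqP; rewrite -subr_eq0 -natrB ?leq_exp2r //.
rewrite (proj1 (pcharf0P k) k_char0) subn_eq0 leq_exp2r // => le_ba.
by apply/eqP; rewrite eqn_leq le_ab.
Qed.

Close Scope ring_scope.

Theorem theorem0p3 (k : closedFieldType) (p : nat)
    (hk : ([pchar k] =i pred0)%R) (hp : prime p) (hodd : odd p) :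
  exists H : nat -> hopfAlgType k,
    (forall n : nat, pointed (H n) /\ \dim (@fullv k (H n)) = p ^ 4) /\
    (forall m n : nat, m <> n -> ~ hopf_isomorphic (H m) (H n)).
Proof.
have [q q_prim] := prim_root_exists hk hp.
pose d := QDatum hp hodd q_prim.
exists (fun n => linked d (n%:R)%R); split=> [n|m n mn].
  split; first exact: model_pointed (standard_hopf_model d n%:R).
  exact: dim_linked.
move/(hopf_isomorphic_link (standard_hopf_model d m%:R) (standard_hopf_model d n%:R)).
by move/(natr_exp_inj hk (prime_gt0 hp)).
Qed.
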